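(* Let $V'$ be an irreducible $\mathbb{Z}^d$-graded $\mathfrak g$-module, where $\mathfrak g=\mathrm{Der}(\mathbb{C}_q)\ltimes\mathbb{C}_q$, with finite dimensional weight spaces with respect to $\tilde{\mathfrak h}$, such that the action of $\mathbb{C}_q^{(1)}$ on $V'$ is associative, the action of $\mathbb{C}_q^{(2)}$ on $V'$ is anti-associative, and $t^0$ acts as the identity. Then there exist $\alpha\in\mathbb{C}^d$ and a finite dimensional irreducible $gl_d$-module $V$ such that $V'\cong F^{\alpha}(V)$ as $\mathfrak g$-modules.
   Context: All vector spaces are over $\mathbb{C}$, and $(u,n)=\sum_i u_i n_i$ for $u,n\in\mathbb{C}^d$. Let $q=(q_{ij})$ be a $d\times d$ matrix whose entries are roots of unity, with $q_{ii}=1$ and $q_{ij}^{-1}=q_{ji}$. The quantum torus $\mathbb{C}_q$ is the unital associative algebra generated by $t_1^{\pm1},\dots,t_d^{\pm1}$ with relations $t_it_i^{-1}=t_i^{-1}t_i=1$, $t_it_j=q_{ij}t_jt_i$. For $n\in\mathbb{Z}^d$ put $t^n=t_1^{n_1}\cdots t_d^{n_d}$; these form a basis of $\mathbb{C}_q$. Put $\sigma(n,m)=\prod_{1\le i<j\le d}q_{ji}^{n_jm_i}$ and $f(n,m)=\sigma(n,m)\sigma(m,n)^{-1}$, so $t^nt^m=\sigma(n,m)t^{n+m}$. Let $\mathrm{rad}(f)=\{n\in\mathbb{Z}^d: f(n,m)=1\ \forall m\in\mathbb{Z}^d\}$. $\mathrm{Der}(\mathbb{C}_q)$ is the Lie algebra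 of derivations of $\mathbb{C}_q$. Let $\partial_i(t^n)=n_it^n$, let $D(u,r)=t^r\sum_i u_i\partial_i$ for $u\in\mathbb{C}^d$, $r\in\mathrm{rad}(f)$, and let $\mathrm{ad}\,t^s$ be the inner derivation $t^m\mapsto(\sigma(s,m)-\sigma(m,s))t^{s+m}$ (zero if $s\in\mathrm{rad}(f)$). $\mathrm{Der}(\mathbb{C}_q)$ is spanned by all $D(u,r)$ ($u\in\mathbb{C}^d$, $r\in\mathrm{rad}(f)$) and all $\mathrm{ad}\,t^s$ ($s\notin\mathrm{rad}(f)$). The Lie algebra $\mathfrak g=\mathrm{Der}(\mathbb{C}_q)\ltimes\mathbb{C}_q$ contains $\mathrm{Der}(\mathbb{C}_q)$ as a subalgebra and $\mathbb{C}_q$ as an ideal, with brackets $[D(u,r),t^n]=(u,n)\sigma(r,n)t^{r+n}$, $[\mathrm{ad}\,t^s,t^n]=(\sigma(s,n)-\sigma(n,s))t^{s+n}$, $[t^m,t^n]=(\sigma(m,n)-\sigma(n,m))t^{m+n}$. Put $\tilde{\mathfrak h}=\{D(u,0):u\in\mathbb{C}^d\}\oplus\mathbb{C}$, where $\mathbb{C}=\mathbb{C}t^0$. Put $\mathbb{C}_q^{(1)}=\mathbb{C}_q\subset\mathfrak g$ and $\mathbb{C}_q^{(2)}=\mathrm{span}\{\mathrm{ad}\,t^n-t^n:n\in\mathbb{Z}^d\}\subset\mathfrak g$, the latter with the associative product $(\mathrm{ad}\,t^n-t^n)(\mathrm{ad}\,t^m-t^m)=\sigma(n,m)(\mathrm{ad}\,t^{n+m}-t^{n+m})$.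 The action of $\mathbb{C}_q^{(1)}$ on a module is associative if $x(yv)=(xy)v$ for all $x,y\in\mathbb{C}_q^{(1)}$ and all $v$; the action of $\mathbb{C}_q^{(2)}$ is anti-associative if $x(yv)=-(yx)v$ for all $x,y\in\mathbb{C}_q^{(2)}$ and all $v$ (products taken in $\mathbb{C}_q^{(1)}$, resp. $\mathbb{C}_q^{(2)}$). That $V'$ is $\mathbb{Z}^d$-graded with finite dimensional weight spaces means that for some fixed $\alpha_0\in\mathbb{C}^d$ one has $V'=\bigoplus_{r\in\mathbb{Z}^d}V'_r$ with $V'_r=\{v\in V': D(u,0)v=(u,r+\alpha_0)v\ \forall u\in\mathbb{C}^d\}$ finite dimensional. For a finite dimensional irreducible $gl_d$-module $V$ and $\alpha\in\mathbb{C}^d$, $F^\alpha(V)$ is the $\mathfrak g$-module $V\otimes\mathbb{C}_q$ with, writing $v(n)=v\otimes t^n$, $\mathrm{ad}\,t^s\,v(n)=(\sigma(s,n)-\sigma(n,s))v(n+s)$ for $s\notin\mathrm{rad}(f)$; $D(u,r)v(n)=\sigma(r,n)\big(((u,n+\alpha)+ru^T)v\big)(r+n)$ for $r\in\mathrm{rad}(f)$, $u\in\mathbb{C}^d$; $t^mv(n)=\sigma(m,n)v(m+n)$ for $m\in\mathbb{Z}^d$; where $ru^T=\sum_{i,j}r_iu_jE_{ij}\in gl_d$ acts on $V$. *)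

(* Defs.v *)
(* Everything is developed over an arbitrary field [C]; the complex numbers are
   substituted for it in the theorem.  The index group Z^d is ['rV[int]_d]. *)

From HB Require Import structures.
From mathcomp Require Import all_boot all_order all_algebra.
From mathcomp Require Import finmap ring.
From mathcomp.multinomials Require Import monalg.
From mathcomp Require Import mathcomp_extra boolp functions.

Set Implicit Arguments.
Unset Strict Implicit.
Unset Printing Implicit Defensive.

Import Order.TTheory GRing.Theory Num.Theory.
Local Open Scope ring_scope.

(* Finitely supported functions K -> V; the operations are locked so that
   unification does not unfold them. *)
Definition fsupp (K : choiceType) (V : zmodType) : Type := {malg V[K]}.

HB.instance Definition _ (K : choiceType) (V : zmodType) :=
  Choice.on (fsupp K V).

HB.lock Definition fszero (K : choiceType) (V : zmodType) : fsupp K V :=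
  (0 : {malg V[K]}).

HB.lock Definition fsopp (K : choiceType) (V : zmodType) (x : fsupp K V)
  : fsupp K V := - (x : {malg V[K]}).

HB.lock Definition fsadd (K : choiceType) (V : zmodType) (x y : fsupp K V)
  : fsupp K V := (x : {malg V[K]}) + y.

HB.lock Definition fsscale (C : fieldType) (K : choiceType) (V : lmodType C)
    (c : C) (x : fsupp K V) : fsupp K V :=
  [malg k in msupp x => c *: x@_k].

(* The function with value v at k and 0 elsewhere. *)
HB.lock Definition fsdelta (K : choiceType) (V : zmodType) (v : V) (k : K)
  : fsupp K V := << v *g k >>.

HB.lock Definition fscoef (K : choiceType) (V : zmodType) (k : K)
    (x : fsupp K V) : V := x@_k.

Lemma fsP (K : choiceType) (V : zmodType) (x y : fsupp K V) :
  (forall k, fscoef k x = fscoef k y) -> x = y.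
Proof. by rewrite fscoef.unlock => xy; apply/malgP. Qed.

Section FsuppZmod.
Variables (K : choiceType) (V : zmodType).

Lemma fscoef0_ k : fscoef k (fszero K V) = 0.
Proof. by rewrite fszero.unlock fscoef.unlock; exact: mcoeff0. Qed.
Lemma fscoefD_ k (x y : fsupp K V) :
  fscoef k (fsadd x y) = fscoef k x + fscoef k y.
Proof. by rewrite fsadd.unlock fscoef.unlock; exact: mcoeffD. Qed.
Lemma fscoefN_ k (x : fsupp K V) : fscoef k (fsopp x) = - fscoef k x.
Proof. by rewrite fsopp.unlock fscoef.unlock; exact: mcoeffN. Qed.

Lemma fsaddA : associative (@fsadd K V).
Proof. by move=> x y z; apply: fsP => k; rewrite !fscoefD_ addrA. Qed.
Lemma fsaddC : commutative (@fsadd K V).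
Proof. by move=> x y; apply: fsP => k; rewrite !fscoefD_ addrC. Qed.
Lemma fsadd0 : left_id (fszero K V) (@fsadd K V).
Proof. by move=> x; apply: fsP => k; rewrite fscoefD_ fscoef0_ add0r. Qed.
Lemma fsaddN : left_inverse (fszero K V) (@fsopp K V) (@fsadd K V).
Proof.
by move=> x; apply: fsP => k; rewrite fscoefD_ fscoefN_ fscoef0_ addNr.
Qed.

HB.instance Definition _ := GRing.isZmodule.Build (fsupp K V)
  fsaddA fsaddC fsadd0 fsaddN.

Lemma fscoef0 k : fscoef k (0 : fsupp K V) = 0.
Proof. exact: fscoef0_. Qed.
Lemma fscoefD k (x y : fsupp K V) : fscoef k (x + y) = fscoef k x + fscoef k y.
Proof. exact: fscoefD_. Qed.

Lemma fscoef_delta (k l : K) (v : V) : fscoef k (fsdelta v l) = v *+ (l == k).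
Proof. by rewrite fsdelta.unlock fscoef.unlock; exact: mcoeffU. Qed.

Lemma msupp_delta (k : K) (v : V) :
  msupp (fsdelta v k) = if v == 0 then fset0 else [fset k]%fset.
Proof. by rewrite fsdelta.unlock; exact: msuppU. Qed.

Lemma fscoef_sum k (I : Type) (r : seq I) (F : I -> fsupp K V) :
  fscoef k (\sum_(i <- r) F i) = \sum_(i <- r) fscoef k (F i).
Proof. exact: (big_morph (fscoef k) (fscoefD k) (fscoef0 k)). Qed.

Lemma fs_outdom k (x : fsupp K V) : k \notin msupp x -> fscoef k x = 0.
Proof. by rewrite fscoef.unlock; exact: mcoeff_outdom. Qed.

Lemma fsE (x : fsupp K V) : x = \sum_(k <- msupp x) fsdelta (fscoef k x) k.
Proof.
apply: fsP => l; rewrite fscoef_sum.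
under eq_bigr => k _ do rewrite fscoef_delta.
case: (boolP (l \in msupp x)) => lx.
  rewrite (bigD1_seq l) //= eqxx mulr1n big1 ?addr0 // => k kl.
  by rewrite (negPf kl).
rewrite fs_outdom // big_seq big1 // => k kx.
by case: eqP kx lx => // -> ->.
Qed.

End FsuppZmod.

Section FsuppLmod.
Variables (C : fieldType) (K : choiceType) (V : lmodType C).
Implicit Types x y : fsupp K V.

Lemma fscoefZ_ k c x : fscoef k (fsscale c x) = c *: fscoef k x.
Proof.
rewrite fsscale.unlock fscoef.unlock mcoeffE; case: ifPn => // kN.
by rewrite mcoeff_outdom // scaler0.
Qed.

Lemma fsscaleA a b x : fsscale a (fsscale b x) = fsscale (a * b) x.
Proof. by apply: fsP => k; rewrite !fscoefZ_ scalerA. Qed.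
Lemma fsscale1 : left_id 1 (@fsscale C K V).
Proof. by move=> x; apply: fsP => k; rewrite fscoefZ_ scale1r. Qed.
Lemma fsscaleDr : right_distributive (@fsscale C K V) +%R.
Proof.
by move=> c x y; apply: fsP => k; rewrite fscoefD !fscoefZ_ fscoefD scalerDr.
Qed.
Lemma fsscaleDl x : {morph (@fsscale C K V)^~ x : a b / a + b}.
Proof. by move=> a b; apply: fsP => k; rewrite fscoefD !fscoefZ_ scalerDl. Qed.

HB.instance Definition _ := GRing.Zmodule_isLmodule.Build C (fsupp K V)
  fsscaleA fsscale1 fsscaleDr fsscaleDl.

Lemma fscoefZ k c x : fscoef k (c *: x) = c *: fscoef k x.
Proof. exact: fscoefZ_. Qed.

Lemma fscoef_linear k : linear (@fscoef K V k).
Proof. by move=> c x y; rewrite fscoefD fscoefZ. Qed.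
HB.instance Definition _ k := GRing.isLinear.Build C (fsupp K V) V *:%R
  (@fscoef K V k) (fscoef_linear k).

Lemma fsdelta_linear k : linear (fun v : V => fsdelta v k).
Proof.
move=> c v w; apply: fsP => l; rewrite fscoefD fscoefZ !fscoef_delta.
by case: eqP => _; rewrite ?mulr1n // !mulr0n scaler0 addr0.
Qed.

Lemma linear_fs_ext (W : lmodType C) (f g : fsupp K V -> W) :
  linear f -> linear g ->
  (forall v k, f (fsdelta v k) = g (fsdelta v k)) -> f =1 g.
Proof.
move=> lf lg fg a.
pose hf := GRing.isLinear.Build _ _ _ _ f lf.
pose hg := GRing.isLinear.Build _ _ _ _ g lg.
pose f' : {linear fsupp K V -> W} := HB.pack f hf.
pose g' : {linear fsupp K V -> W} := HB.pack g hg.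
rewrite -[f a]/(f' a) -[g a]/(g' a) [a]fsE !linear_sum.
by apply: eq_bigr => k _; exact: fg.
Qed.

End FsuppLmod.

HB.lock Definition lext (C : fieldType) (K : choiceType) (V : lmodType C)
    (h : K -> V) (a : fsupp K C^o) : V :=
  \sum_(k <- msupp a) (fscoef k a : C) *: h k.

Section LinearExtension.
Variables (C : fieldType) (K : choiceType) (V : lmodType C).
Implicit Types (h : K -> V) (a b : fsupp K C^o).

Lemma lextEw (D : {fset K}) h a : (msupp a `<=` D)%fset ->
  lext h a = \sum_(k <- D) (fscoef k a : C) *: h k.
Proof.
move=> sD; rewrite lext.unlock (big_fset_incl _ sD) // => k _ kN.
by rewrite fs_outdom // scale0r.
Qed.

Lemma lext_is_linear h : linear (lext h).
Proof.
move=> c a b; pose D := (msupp a `|` msupp b `|` msupp (c *: a + b)%R)%fset.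
rewrite !(@lextEw D);
  try by apply/fsubsetP => k ka; rewrite !inE ka ?orbT.
rewrite scaler_sumr -big_split /=; apply: eq_bigr => k _.
by rewrite fscoefD fscoefZ scalerDl scalerA.
Qed.

HB.instance Definition _ h :=
  GRing.isLinear.Build C (fsupp K C^o) V *:%R (lext h) (lext_is_linear h).

Lemma lext_delta h k : lext h (fsdelta (1 : C^o) k) = h k.
Proof.
rewrite lext.unlock msupp_delta oner_eq0 big_seq_fset1.
by rewrite fscoef_delta eqxx scale1r.
Qed.

Lemma lext_addl c h1 h2 a :
  lext (fun k => c *: h1 k + h2 k) a = c *: lext h1 a + lext h2 a.
Proof.
rewrite lext.unlock scaler_sumr -big_split; apply: eq_bigr => k _ /=.
by rewrite scalerDr !scalerA mulrC.
Qed.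

Lemma eq_lext h1 h2 : h1 =1 h2 -> lext h1 =1 lext h2.
Proof. by move=> e a; rewrite lext.unlock; apply: eq_bigr => k _; rewrite e. Qed.

End LinearExtension.

(* A Lie algebra is given as a vector space [L] with its bracket [br]. *)

Section LieModules.
Variables (C : fieldType) (L : lmodType C) (br : L -> L -> L).

Record lie_module (V : lmodType C) (act : L -> V -> V) : Prop := LieModule {
  lie_act_linearr : forall x, linear (act x);
  lie_act_linearl : forall v, linear (act^~ v);
  lie_act_br : forall x y v,
    act (br x y) v = act x (act y v) - act y (act x v) }.

Record lie_submodule (V : lmodType C) (act : L -> V -> V) (W : V -> Prop)
    : Prop := LieSubmodule {
  lie_sub0 : W 0;
  lie_subD : forall v w, W v -> W w -> W (v + w);
  lie_subZ : forall c v, W v -> W (c *: v);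
  lie_sub_act : forall x v, W v -> W (act x v) }.

Definition lie_irreducible (V : lmodType C) (act : L -> V -> V) : Prop :=
  (exists v : V, v <> 0) /\
  forall W : V -> Prop, lie_submodule act W ->
    (forall v, W v -> v = 0) \/ (forall v, W v).

Definition lie_isomorphic (V1 V2 : lmodType C)
    (act1 : L -> V1 -> V1) (act2 : L -> V2 -> V2) : Prop :=
  exists phi : V1 -> V2, [/\ linear phi, bijective phi
    & forall x v, phi (act1 x v) = act2 x (phi v)].

End LieModules.

Definition gl_br (C : fieldType) (d : nat) (A B : 'M[C]_d) : 'M[C]_d :=
  A *m B - B *m A.

Section Gradings.
Variables (C : fieldType) (V : lmodType C).

Definition fin_dim (W : V -> Prop) : Prop :=
  exists (n : nat) (e : 'I_n -> V), (forall i, W (e i)) /\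
    forall v, W v -> exists c : 'I_n -> C, v = \sum_i c i *: e i.

(* V is the internal direct sum of the family (W i), indexed by a possibly
   infinite set. *)
Definition direct_sum (I : eqType) (W : I -> V -> Prop) : Prop :=
  (forall v, exists (s : seq I) (w : I -> V),
     [/\ uniq s, forall i, W i (w i) & v = \sum_(i <- s) w i]) /\
  (forall (s : seq I) (w : I -> V), uniq s -> (forall i, W i (w i)) ->
     \sum_(i <- s) w i = 0 -> forall i, i \in s -> w i = 0).

End Gradings.

Record quantum_matrix (C : fieldType) (d : nat) := QuantumMatrix {
  qmx :> 'M[C]_d;
  qmx_root : forall i j, exists2 n : nat, (0 < n)%N & qmx i j ^+ n = 1;
  qmx_diag : forall i, qmx i i = 1;
  qmx_inv : forall i j, (qmx i j)^-1 = qmx j i }.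

HB.lock Definition sigma (C : fieldType) (d : nat) (q : quantum_matrix C d)
    (n m : 'rV[int]_d) : C :=
  \prod_(i < d) \prod_(j < d | (i < j)%N) q j i ^ (n 0 j * m 0 i).

(* C_q is the twisted group algebra with basis (t^n) and t^n t^m =
   sigma(n,m) t^(n+m); that it satisfies the defining relations and that t^n is
   t_1^n_1 ... t_d^n_d is checked below (tgen_comm, qmonE). *)
Definition qtorus (C : fieldType) (d : nat) of quantum_matrix C d :=
  fsupp 'rV[int]_d C^o.

HB.instance Definition _ (C : fieldType) (d : nat) (q : quantum_matrix C d) :=
  GRing.Lmodule.on (qtorus q).

HB.lock Definition qmon (C : fieldType) (d : nat) (q : quantum_matrix C d)
    (n : 'rV[int]_d) : qtorus q := fsdelta 1 n.

HB.lock Definition qmul (C : fieldType) (d : nat) (q : quantum_matrix C d)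
    (a b : qtorus q) : qtorus q :=
  lext (fun n => lext (fun m => sigma q n m *: qmon q (n + m)) b) a.

Section QuantumTorus.
Variables (C : fieldType) (d : nat) (q : quantum_matrix C d).

Local Notation Zd := 'rV[int]_d.
Local Notation Cd := 'rV[C]_d.
Local Notation Cq := (qtorus q).
Local Notation sigma := (sigma q).
Local Notation qmon := (qmon q).
Local Notation qmul := (@qmul C d q).

Definition commf (n m : Zd) : C := sigma n m * (sigma m n)^-1.

Definition in_rad (n : Zd) : Prop := forall m, commf n m = 1.

Lemma qmx_neq0 i j : q i j != 0.
Proof.
have [n n_gt0 qn] := qmx_root q i j; apply/eqP => q0.
by move: qn; rewrite q0 expr0n gtn_eqF //= => /eqP; rewrite eq_sym oner_eq0.
Qed.

Lemma sigma_neq0 n m : sigma n m != 0.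
Proof.
by rewrite sigma.unlock; apply/prodf_neq0 => i _; apply/prodf_neq0 => j _; rewrite expfz_neq0 ?qmx_neq0.
Qed.

Lemma sigmaDl n n' m : sigma (n + n') m = sigma n m * sigma n' m.
Proof.
rewrite sigma.unlock -big_split; apply: eq_bigr => i _; rewrite -big_split.
by apply: eq_bigr => j _; rewrite mxE mulrDl expfzDr ?qmx_neq0.
Qed.

Lemma sigmaDr n m m' : sigma n (m + m') = sigma n m * sigma n m'.
Proof.
rewrite sigma.unlock -big_split; apply: eq_bigr => i _; rewrite -big_split.
by apply: eq_bigr => j _; rewrite mxE mulrDr expfzDr ?qmx_neq0.
Qed.

Lemma sigma0l m : sigma 0 m = 1.
Proof. by rewrite sigma.unlock; apply: big1 => i _; apply: big1 => j _; rewrite mxE mul0r. Qed.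

Lemma sigma0r n : sigma n 0 = 1.
Proof. by rewrite sigma.unlock; apply: big1 => i _; apply: big1 => j _; rewrite mxE mulr0. Qed.

Lemma commf_eq1 n m : (commf n m = 1) <-> (sigma n m = sigma m n).
Proof.
rewrite /commf; split=> [e|->]; last by rewrite mulfV ?sigma_neq0.
by rewrite -[LHS](mulfVK (sigma_neq0 m n)) e mul1r.
Qed.

Lemma in_radE n : in_rad n <-> forall m, sigma n m = sigma m n.
Proof. by split=> h m; apply/commf_eq1/h. Qed.

Lemma in_rad0 : in_rad 0.
Proof. by apply/in_radE => m; rewrite sigma0l sigma0r. Qed.

Definition qcoef (k : Zd) (x : Cq) : C := fscoef k x.

Lemma qcoef_linear k : linear (qcoef k : Cq -> C^o).
Proof. exact: fscoef_linear. Qed.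
Lemma qcoef_qmon k n : qcoef k (qmon n) = (n == k)%:R.
Proof. by rewrite /qcoef qmon.unlock fscoef_delta. Qed.

Lemma qmon_ext (V : lmodType C) (f g : Cq -> V) :
  linear f -> linear g -> (forall n, f (qmon n) = g (qmon n)) -> f =1 g.
Proof.
move=> lf lg fg.
have lin0 (h : Cq -> V) : linear h -> h 0 = 0.
  move=> lh; have := lh 1 0 0; rewrite !scale1r addr0 => e.
  by apply: (addrI (h 0)); rewrite addr0 -e.
apply: (linear_fs_ext lf lg) => v n.
have -> : fsdelta v n = (v : C) *: qmon n + 0.
  apply: fsP => k; rewrite -/(qcoef k (_ + _)) qcoef_linear qcoef_qmon.
  rewrite [qcoef k 0]fscoef0 addr0 fscoef_delta [RHS]/GRing.scale /=.
  by case: eqP; rewrite ?mulr1n ?mulr0n ?mulr0 ?mulr1.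
by rewrite lf lg fg !lin0.
Qed.

Lemma qmulUU n m : qmul (qmon n) (qmon m) = sigma n m *: qmon (n + m).
Proof. by rewrite qmul.unlock qmon.unlock !lext_delta. Qed.

Lemma qmul_linearl b : linear (qmul^~ b).
Proof. by move=> c x y; rewrite qmul.unlock linearP. Qed.

Lemma qmul_linearr a : linear (qmul a).
Proof.
move=> c x y; rewrite qmul.unlock.
pose h z n := lext (fun m => sigma n m *: qmon (n + m)) z.
transitivity (lext (fun n => c *: h x n + h y n) a); last exact: lext_addl.
by apply: eq_lext => n; exact: linearP.
Qed.

Lemma qmulDl : left_distributive qmul +%R.
Proof. by move=> x y z; rewrite -[x]scale1r qmul_linearl !scale1r. Qed.

Lemma qmulDr : right_distributive qmul +%R.
Proof. by move=> x y z; rewrite -[y]scale1r qmul_linearr !scale1r. Qed.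

Lemma qmul0l b : qmul 0 b = 0.
Proof. by apply: (addrI (qmul 0 b)); rewrite -qmulDl !addr0. Qed.

Lemma qmul0r b : qmul b 0 = 0.
Proof. by apply: (addrI (qmul b 0)); rewrite -qmulDr !addr0. Qed.

Lemma qmulZl c a b : c *: qmul a b = qmul (c *: a) b.
Proof. by rewrite -[c *: a]addr0 qmul_linearl qmul0l addr0. Qed.

Lemma qmulZr c a b : c *: qmul a b = qmul a (c *: b).
Proof. by rewrite -[c *: b]addr0 qmul_linearr qmul0r addr0. Qed.

Lemma qmul1l : left_id (qmon 0) qmul.
Proof.
apply: qmon_ext; [exact: qmul_linearr | by [] | move=> n].
by rewrite qmulUU sigma0l scale1r add0r.
Qed.

Lemma qmul1r : right_id (qmon 0) qmul.
Proof.
apply: qmon_ext; [exact: qmul_linearl | by [] | move=> n].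
by rewrite qmulUU sigma0r scale1r addr0.
Qed.

Lemma qmulA : associative qmul.
Proof.
move=> x y z; move: x; apply: qmon_ext.
- exact: qmul_linearl.
- by move=> c u v; rewrite qmul_linearl qmul_linearl.
move=> n; move: y; apply: qmon_ext.
- by move=> c u v; rewrite qmul_linearl qmul_linearr.
- by move=> c u v; rewrite qmul_linearr qmul_linearl.
move=> m; move: z; apply: qmon_ext.
- by move=> c u v; rewrite [qmul (qmon m) _]qmul_linearr qmul_linearr.
- exact: qmul_linearr.
move=> p; rewrite !qmulUU -qmulZl -qmulZr !qmulUU !scalerA addrA.
by rewrite sigmaDr sigmaDl mulrC mulrA.
Qed.

Lemma qmon_neq0 n : qmon n != 0.
Proof. apply/eqP => /(congr1 (fscoef n)); rewrite qmon.unlock fscoef_delta eqxx.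
by rewrite fscoef0 => /eqP; rewrite oner_eq0. Qed.

HB.instance Definition _ := GRing.Zmodule_isNzRing.Build Cq
  qmulA qmul1l qmul1r qmulDl qmulDr (qmon_neq0 0).
HB.instance Definition _ := GRing.Lmodule_isLalgebra.Build C Cq qmulZl.
HB.instance Definition _ := GRing.Lalgebra_isAlgebra.Build C Cq qmulZr.

Lemma qmonM n m : qmon n * qmon m = sigma n m *: qmon (n + m).
Proof. exact: qmulUU. Qed.

Lemma qmon0 : qmon 0 = 1.
Proof. by []. Qed.

Definition tgen (i : 'I_d) : Cq := qmon (delta_mx 0 i).

Lemma sigma_eq1 (n m : Zd) :
  (forall i j : 'I_d, (i < j)%N -> n 0 j * m 0 i = 0) -> sigma n m = 1.
Proof.
by rewrite sigma.unlock; move=> h; apply: big1 => i _; apply: big1 => j ij; rewrite h.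
Qed.

Lemma sigma_delta (i j : 'I_d) :
  sigma (delta_mx 0 i) (delta_mx 0 j) = if (j < i)%N then q i j else 1.
Proof.
rewrite sigma.unlock (bigD1 j) //= [X in _ * X]big1 ?mulr1; last first.
  move=> a aj; apply: big1 => b _.
  by rewrite !mxE (negPf aj) mulr0.
case: ifP => ji; last first.
  apply: big1 => b jb; rewrite !mxE !eqxx /=.
  by case: eqP jb ji => [->->|]//; rewrite mul0r.
rewrite (bigD1 i) //= !mxE !eqxx big1 ?mulr1 // => b /andP[_ bi].
by rewrite !mxE (negPf bi) mul0r.
Qed.

Lemma tgen_comm i j : tgen i * tgen j = q i j *: (tgen j * tgen i).
Proof.
rewrite !qmonM !sigma_delta scalerA addrC; congr (_ *: _).
case: ltngtP => [ij|ij|/val_inj->]; rewrite ?mulr1 ?qmx_diag //.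
by rewrite -qmx_inv mulVf ?qmx_neq0.
Qed.

Lemma sigmaNl n m : sigma (- n) m = (sigma n m)^-1.
Proof.
by apply: (mulIf (sigma_neq0 n m)); rewrite -sigmaDl addNr sigma0l mulVf ?sigma_neq0.
Qed.

Lemma sigmaNr n m : sigma n (- m) = (sigma n m)^-1.
Proof.
by apply: (mulIf (sigma_neq0 n m)); rewrite -sigmaDr addNr sigma0r mulVf ?sigma_neq0.
Qed.

Lemma qmonVM n : (sigma n n *: qmon (- n)) * qmon n = 1.
Proof.
by rewrite -scalerAl qmonM scalerA sigmaNl mulfV ?sigma_neq0 // scale1r addNr.
Qed.

Lemma qmonMV n : qmon n * (sigma n n *: qmon (- n)) = 1.
Proof.
by rewrite -scalerAr qmonM scalerA sigmaNr mulfV ?sigma_neq0 // scale1r subrr.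
Qed.

Lemma tgenX i k : tgen i ^+ k = qmon (k%:Z *: delta_mx 0 i).
Proof.
elim: k => [|k IHk]; first by rewrite scale0r.
rewrite exprS IHk qmonM sigma_eq1 => [|a b ab].
  by rewrite scale1r intS scalerDl scale1r.
rewrite !mxE /=; case: (b =P i) => [bi|_]; last by rewrite mul0r.
case: (a =P i) => [ai|_]; last by rewrite !mulr0.
by rewrite bi ai ltnn in ab.
Qed.

Lemma tgenXV i k : tgen i ^+ k * qmon (- k%:Z *: delta_mx 0 i) = 1.
Proof.
rewrite tgenX qmonM scaleNr subrr sigma_eq1 => [|a b ab]; first by rewrite scale1r.
rewrite !mxE /=; case: (b =P i) => [bi|_]; last by rewrite mulr0 mul0r.
case: (a =P i) => [ai|_]; last by rewrite !mulr0.
by rewrite bi ai ltnn in ab.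
Qed.

Lemma qmonE n : qmon n = \prod_(i < d) qmon (n 0 i *: delta_mx 0 i).
Proof.
rewrite [in LHS](row_sum_delta n).
have: sorted (fun i j : 'I_d => (i < j)%N) (index_enum 'I_d).
  have := iota_ltn_sorted 0 d.
  by rewrite -val_enum_ord sorted_map enumT /index_enum.
elim: (index_enum _) => [|i s IHs] sd; first by rewrite !big_nil.
rewrite !big_cons -IHs ?(path_sorted sd) // qmonM sigma_eq1 ?scale1r // => a b ab.
rewrite !mxE /=; case: (b =P i) => [bi|_]; last by rewrite mulr0 mul0r.
rewrite summxE big1_seq ?mulr0 // => c /andP[_ cs].
have ic : (i < c)%N.
  have tr : transitive (fun x y : 'I_d => (x < y)%N).
    by move=> y x z; apply: ltn_trans.
  by have /allP/(_ _ cs) := order_path_min tr sd.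
rewrite !mxE /=; case: (a =P c) => [ac|_]; last by rewrite mulr0.
by rewrite -ac -bi ltnNge ltnW in ic.
Qed.

End QuantumTorus.

Section Derivations.
Variables (C : fieldType) (A : algType C).

Definition is_derivation (f : A -> A) : Prop :=
  linear f /\ forall x y, f (x * y) = f x * y + x * f y.

Definition derivation : {pred A -> A} := fun f => `[< is_derivation f >].

Lemma derivation_submod_closed : submod_closed derivation.
Proof.
split=> [|c f g].
  apply/asboolP; split=> [k x y|x y] /=; first by rewrite scaler0 addr0.
  by rewrite mul0r mulr0 addr0.
move=> /asboolP[fl fd] /asboolP[gl gd]; apply/asboolP; split=> [k x y|x y].
  rewrite -![(c *: f + g) _]/(c *: f _ + g _) fl gl !scalerDr !scalerA mulrC.
  by rewrite addrACA.
rewrite -![(c *: f + g) _]/(c *: f _ + g _) fd gd !mulrDl !mulrDr scalerDr.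
by rewrite scalerAl scalerAr addrACA.
Qed.

HB.instance Definition _ :=
  GRing.isSubmodClosed.Build C (A -> A) derivation derivation_submod_closed.

Record der := MkDer { der_fun :> A -> A; _ : der_fun \in derivation }.

HB.instance Definition _ := [isSub for der_fun].
HB.instance Definition _ := [Choice of der by <:].
HB.instance Definition _ := [SubChoice_isSubLmodule of der by <:].

Definition Der (f : A -> A) (fP : is_derivation f) : der := MkDer (asboolT fP).

Lemma derP (D : der) : is_derivation D.
Proof. by case: D => f /= /asboolP. Qed.

Lemma derD (D E : der) x : (D + E) x = D x + E x. Proof. by []. Qed.
Lemma derZ c (D : der) x : (c *: D) x = c *: D x. Proof. by []. Qed.
Lemma der0 x : (0 : der) x = 0. Proof. by []. Qed.

Lemma der_linear (D : der) : linear D.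
Proof. by case: (derP D). Qed.
HB.instance Definition _ (D : der) :=
  GRing.isLinear.Build C A A *:%R D (der_linear D).

Lemma derM (D : der) x y : D (x * y) = D x * y + x * D y.
Proof. by case: (derP D). Qed.

Lemma der_ext (D E : der) : D =1 E -> D = E.
Proof. by move=> DE; apply: val_inj; apply/funext. Qed.

Lemma der_br_subproof (D E : der) :
  is_derivation (fun x => D (E x) - E (D x)).
Proof.
split=> [c x y|x y]; first by rewrite !linearP scalerDr addrACA.
rewrite !derM !linearD /= !derM mulrBl mulrBr.
move: (D (E x) * y) (E (D x) * y) (D x * E y) (E x * D y) => a b e g.
move: (x * D (E y)) (x * E (D y)) => h i; rewrite !opprD.
rewrite (AC ((2*2)*(2*2)) (((1*5)*(4*8))*((2*7)*(3*6)))) /=.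
by rewrite !subrr !addr0.
Qed.

Definition der_br (D E : der) : der := Der (der_br_subproof D E).

Lemma ad_subproof (a : A) : is_derivation (fun x => a * x - x * a).
Proof.
split=> [c x y|x y].
  by rewrite mulrDr mulrDl -scalerAl -scalerAr scalerBr opprD addrACA.
by rewrite mulrBl mulrBr !mulrA addrA subrK.
Qed.

Definition ad (a : A) : der := Der (ad_subproof a).

Lemma ad_linear : linear ad.
Proof.
move=> c a b; apply: der_ext => x; rewrite derD derZ /=.
by rewrite mulrDr mulrDl -scalerAl -scalerAr scalerBr opprD addrACA.
Qed.

HB.instance Definition _ :=
  GRing.isLinear.Build C A der *:%R ad ad_linear.

(* (D, a) stands for D + a. *)
Definition sdalg : Type := (der * A)%type.

HB.instance Definition _ := GRing.Lmodule.on sdalg.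

Definition sd_br (x y : sdalg) : sdalg :=
  (der_br x.1 y.1, x.1 y.2 - y.1 x.2 + (x.2 * y.2 - y.2 * x.2)).

End Derivations.

Section DerTorus.
Variables (C : fieldType) (d : nat) (q : quantum_matrix C d).

Local Notation Zd := 'rV[int]_d.
Local Notation Cd := 'rV[C]_d.
Local Notation Cq := (qtorus q).
Local Notation sigma := (sigma q).
Local Notation qmon := (qmon q).

Definition dot (u v : Cd) : C := \sum_i u 0 i * v 0 i.

Definition intv (n : Zd) : Cd := map_mx intr n.

Lemma intvD n m : intv (n + m) = intv n + intv m.
Proof. by apply/rowP => i; rewrite !mxE rmorphD. Qed.

Lemma dotDr u v w : dot u (v + w) = dot u v + dot u w.
Proof.
by rewrite /dot -big_split; apply: eq_bigr => i _; rewrite mxE mulrDr.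
Qed.

Lemma ad_qmon s n :
  ad (qmon s : Cq) (qmon n) = (sigma s n - sigma n s) *: qmon (s + n).
Proof.
have -> : ad (qmon s) (qmon n) = qmon s * qmon n - qmon n * qmon s by [].
by rewrite !qmonM [n + s]addrC -scalerBl.
Qed.

Lemma in_rad_central r (x : Cq) : in_rad q r -> qmon r * x = x * qmon r.
Proof.
move=> /in_radE rr; move: x; apply: qmon_ext => [c x y|c x y|n].
- by rewrite mulrDr scalerAr.
- by rewrite mulrDl scalerAl.
- by rewrite !qmonM rr addrC.
Qed.

Lemma lext_qmon (V : lmodType C) (h : Zd -> V) n : lext h (qmon n : Cq) = h n.
Proof. by rewrite qmon.unlock lext_delta. Qed.

Definition qpartial (i : 'I_d) (x : Cq) : Cq :=
  lext (fun n : Zd => (n 0 i)%:~R *: qmon n) x.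

Lemma qpartial_qmon i n : qpartial i (qmon n) = (n 0 i)%:~R *: qmon n.
Proof. exact: lext_qmon. Qed.

Lemma qpartial_linear i : linear (qpartial i).
Proof. by move=> c x y; rewrite /qpartial; exact: linearP. Qed.

HB.instance Definition _ i :=
  GRing.isLinear.Build C Cq Cq *:%R (qpartial i) (qpartial_linear i).

Lemma qpartialM i x y :
  qpartial i (x * y) = qpartial i x * y + x * qpartial i y.
Proof.
move: x; apply: qmon_ext => [c u v|c u v|n].
- by rewrite mulrDl -scalerAl linearP.
- by rewrite linearP !mulrDl -!scalerAl scalerDr addrACA.
move: y; apply: qmon_ext => [c u v|c u v|m].
- by rewrite mulrDr -scalerAr linearP.
- by rewrite linearP !mulrDr -!scalerAr scalerDr addrACA.
rewrite qmonM linearZ /= !qpartial_qmon -scalerAl -scalerAr qmonM.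
by rewrite !scalerA -scalerDl mxE rmorphD mulrDr ![sigma n m * _]mulrC.
Qed.

Definition Dfun (u : Cd) (r : Zd) (x : Cq) : Cq :=
  qmon r * \sum_(i < d) u 0 i *: qpartial i x.

Lemma Dfun_subproof u r : in_rad q r -> is_derivation (Dfun u r).
Proof.
move=> rr; split=> [c x y|x y]; rewrite /Dfun.
  rewrite scalerAr -mulrDr scaler_sumr -big_split /=; congr (_ * _).
  by apply: eq_bigr => i _; rewrite linearP scalerDr !scalerA mulrC.
rewrite [x * (_ * _)]mulrA -(in_rad_central x rr) -!mulrA -mulrDr; congr (_ * _).
rewrite mulr_suml mulr_sumr -big_split /=; apply: eq_bigr => i _.
by rewrite qpartialM scalerDr scalerAl scalerAr.
Qed.

Definition Dur (u : Cd) (r : Zd) (rr : in_rad q r) : der Cq :=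
  Der (Dfun_subproof u rr).

Lemma Dur_qmon u r (rr : in_rad q r) n :
  Dur u rr (qmon n) = (dot u (intv n) * sigma r n) *: qmon (r + n).
Proof.
rewrite -scalerA -qmonM scalerAr /= /Dfun; congr (_ * _).
rewrite /dot scaler_suml; apply: eq_bigr => i _.
by rewrite qpartial_qmon scalerA mxE.
Qed.

Definition qalg : Type := sdalg Cq.
HB.instance Definition _ := GRing.Lmodule.on qalg.

Definition of_der (D : der Cq) : qalg := (D, 0).

Definition torus1 (a : Cq) : qalg := (0, a).

(* [torus2] is injective, its image is the span C_q^(2) of the ad t^n - t^n,
   and by [torus2M] it carries the product of C_q to that of C_q^(2). *)
Definition torus2 (a : Cq) : qalg := of_der (ad a) - torus1 a.

Lemma torus2E a : torus2 a = (ad a, - a).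
Proof. by congr pair; rewrite ?subr0 ?sub0r. Qed.

Lemma torus2_linear : linear torus2.
Proof.
move=> c a b; rewrite !torus2E; congr pair; first exact: linearP.
by rewrite opprD -scalerN.
Qed.

HB.instance Definition _ :=
  GRing.isLinear.Build C Cq qalg *:%R torus2 torus2_linear.

Lemma torus2_inj : injective torus2.
Proof. by move=> a b; rewrite !torus2E => /(congr1 snd)/oppr_inj. Qed.

Lemma torus2M n m :
  torus2 (qmon n * qmon m) = sigma n m *: torus2 (qmon (n + m)).
Proof. by rewrite qmonM linearZ. Qed.

Section Modules.
Variables (V : lmodType C) (act : qalg -> V -> V).

Definition torus1_associative : Prop := forall a b v,
  act (torus1 a) (act (torus1 b) v) = act (torus1 (a * b)) v.

Definition torus2_antiassociative : Prop := forall a b v,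
  act (torus2 a) (act (torus2 b) v) = - act (torus2 (b * a)) v.

Definition weight_space (alpha0 : Cd) (r : Zd) (v : V) : Prop :=
  forall u : Cd,
    act (of_der (Dur u (in_rad0 q))) v = dot u (intv r + alpha0) *: v.

Definition Zd_graded : Prop := exists alpha0 : Cd,
  direct_sum (weight_space alpha0) /\
  forall r, fin_dim (weight_space alpha0 r).

End Modules.

End DerTorus.

Section DerSpan.
Variables (C : fieldType) (d : nat) (q : quantum_matrix C d).

Local Notation Zd := 'rV[int]_d.
Local Notation Cq := (qtorus q).
Local Notation sigma := (sigma q).
Local Notation qmon := (qmon q).

HB.instance Definition _ k :=
  GRing.isLinear.Build C Cq C^o *:%R (qcoef k) (qcoef_linear k).

Lemma qcoefMr x k m : qcoef (k + m) (x * qmon m) = qcoef k x * sigma k m.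
Proof.
move: x; apply: (@qmon_ext C d q C^o) => [c x y|c x y|n].
- by rewrite mulrDl -scalerAl linearP.
- by rewrite qcoef_linear mulrDl scalerAl.
rewrite qmonM linearZ /= !qcoef_qmon (inj_eq (addIr m)).
by case: eqP => [->|_]; rewrite ?mul1r ?mul0r /GRing.scale /= ?mulr1 ?mulr0.
Qed.

Lemma qcoefMl x k m : qcoef (m + k) (qmon m * x) = sigma m k * qcoef k x.
Proof.
move: x; apply: (@qmon_ext C d q C^o) => [c x y|c x y|n].
- by rewrite mulrDr -scalerAr linearP.
- by rewrite qcoef_linear mulrDr scalerAr.
rewrite qmonM linearZ /= !qcoef_qmon (inj_eq (addrI m)).
by case: eqP => [->|_]; rewrite /GRing.scale /= ?mulr1 ?mulr0.
Qed.

Lemma qcoef_ext (x y : Cq) : (forall k, qcoef k x = qcoef k y) -> x = y.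
Proof. exact: fsP. Qed.

Section OneDerivation.
Variable D : der Cq.

Let c n s : C := qcoef (s + n) (D (qmon n)).

Lemma der_coefD n m s :
  c (n + m) s = c n s * sigma s m + sigma n s * c m s.
Proof.
have e1 : qcoef (s + (n + m)) (D (qmon n) * qmon m) = c n s * sigma (s + n) m.
  by rewrite addrA qcoefMr.
have e2 : qcoef (s + (n + m)) (qmon n * D (qmon m)) = sigma n (s + m) * c m s.
  by rewrite addrCA qcoefMl.
have e3 : qcoef (s + (n + m)) (D (qmon n * qmon m)) = sigma n m * c (n + m) s.
  by rewrite qmonM linearZ linearZ.
move: e3; rewrite derM linearD /= e1 e2 sigmaDl sigmaDr => e3.
apply: (mulfI (sigma_neq0 q n m)); rewrite -e3.
by move: (c n s) (c m s) => a b; ring.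
Qed.

Lemma der_coefC n m s :
  c n s * (sigma s m - sigma m s) = c m s * (sigma s n - sigma n s).
Proof.
have := der_coefD m n s; rewrite addrC der_coefD.
move: (c n s) (c m s) => a b /eqP.
by rewrite -subr_eq0 => /eqP e; apply/eqP; rewrite -subr_eq0 -e; apply/eqP; ring.
Qed.

Lemma der_coef0 s : c 0 s = 0.
Proof.
have := der_coefD 0 0 s; rewrite addr0 sigma0r sigma0l mulr1 mul1r.
by move/eqP; rewrite -subr_eq0 opprD addrA subrr sub0r oppr_eq0 => /eqP.
Qed.

Lemma der_coef_eq0 s : (forall i, c (delta_mx 0 i) s = 0) -> forall n, c n s = 0.
Proof.
move=> c0.
have cD n m : c n s = 0 -> c m s = 0 -> c (n + m) s = 0.
  by move=> cn cm; rewrite der_coefD cn cm mul0r mulr0 addr0.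
have cN n : c n s = 0 -> c (- n) s = 0.
  move=> cn; have := der_coefD n (- n) s.
  rewrite subrr der_coef0 cn mul0r add0r => /eqP.
  by rewrite eq_sym mulf_eq0 (negPf (sigma_neq0 _ _ _)) => /eqP.
move=> n; rewrite (row_sum_delta n).
apply: (big_ind (fun m => c m s = 0)) => [|m m'|i _]; [exact: der_coef0 | exact: cD|].
have cX k : c (delta_mx 0 i *+ k) s = 0.
  by elim: k => [|k IHk]; rewrite ?mulr0n ?der_coef0 // mulrS cD.
case: (n 0 i) => k.
  by rewrite -[Posz k]natz scaler_nat cX.
by rewrite NegzE -natz scaleNr scaler_nat cN.
Qed.

Let S : {fset Zd} :=
  (\bigcup_(i <- enum 'I_d)
     [fset (k - delta_mx 0 i)%R | k in msupp (D (qmon (delta_mx 0 i)))])%fset.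

Lemma der_coef_notin s n : s \notin S -> c n s = 0.
Proof.
move=> sS; apply: der_coef_eq0 => i; apply: contraNeq sS => cs.
apply/bigfcupP; exists i; first by rewrite mem_enum.
apply/imfsetP; exists (s + delta_mx 0 i); last by rewrite addrK.
by rewrite /= -mcoeff_neq0 -[_@__]/(mcoeff _ _); move: cs; rewrite /c /qcoef fscoef.unlock.
Qed.

Lemma der_sum n : D (qmon n) = \sum_(s <- S) c n s *: qmon (s + n).
Proof.
apply: qcoef_ext => k; rewrite linear_sum /=.
have -> : qcoef k (D (qmon n)) = c n (k - n) by rewrite /c subrK.
have cE s : qcoef k (c n s *: qmon (s + n)) = c n s * (s == k - n)%:R.
  rewrite linearZ /= qcoef_qmon [LHS]/GRing.scale /=.
  by rewrite -(inj_eq (addIr n) s) subrK.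
rewrite (eq_bigr _ (fun s _ => cE s)).
case: (boolP (k - n \in S)) => kS; last first.
  rewrite big_seq big1 ?der_coef_notin // => s sS.
  by case: eqP sS kS => [->->|]//; rewrite mulr0.
rewrite (bigD1_seq (k - n)) ?fset_uniq // eqxx mulr1 big1 => [|s sk]; first by rewrite /= addr0.
by rewrite (negPf sk) mulr0.
Qed.

Lemma der_coef_rad s : in_rad q s ->
  forall n, c n s = (\sum_i c (delta_mx 0 i) s / sigma s (delta_mx 0 i)
                       * (n 0 i)%:~R) * sigma s n.
Proof.
move=> /in_radE rs n; pose g m := c m s / sigma s m.
have gD m m' : g (m + m') = g m + g m'.
  rewrite /g der_coefD -rs sigmaDr mulrDl.
  have := sigma_neq0 q s m; have := sigma_neq0 q s m'.
  move: (sigma s m) (sigma s m') => a b b0 a0.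
  by field; rewrite a0 b0.
have g0 : g 0 = 0 by rewrite /g der_coef0 mul0r.
have gN m : g (- m) = - g m.
  by apply/eqP; rewrite -subr_eq0 opprK -gD addNr g0.
have gX m k : g (m *+ k) = g m * k%:R.
  elim: k => [|k IHk]; first by rewrite mulr0n g0 mulr0.
  by rewrite mulrS gD IHk mulrS mulrDr mulr1.
have gZ m (z : int) : g (z *: m) = g m * z%:~R.
  case: z => k; first by rewrite -[Posz k]natz scaler_nat gX natz.
  by rewrite NegzE -natz scaleNr scaler_nat gN gX natz rmorphN mulrN.
suff -> : \sum_i c (delta_mx 0 i) s / sigma s (delta_mx 0 i) * (n 0 i)%:~R = g n.
  by rewrite /g mulfVK ?sigma_neq0.
rewrite [in RHS](row_sum_delta n).
by rewrite (big_morph g gD g0); apply: eq_bigr => i _; rewrite gZ.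
Qed.

End OneDerivation.

Lemma der_spanned (P : der Cq -> Prop) :
  P 0 -> (forall D E, P D -> P E -> P (D + E)) ->
  (forall a D, P D -> P (a *: D)) ->
  (forall u r (rr : in_rad q r), P (Dur u rr)) ->
  (forall s, ~ in_rad q s -> P (ad (qmon s))) ->
  forall D, P D.
Proof.
move=> P0 PD PZ Pu Ps D; have DE := der_sum D.
set S := (X in forall n, _ = \sum_(s <- X) _) in DE.
suff [E PE EE] : exists2 E : der Cq, P E & forall n, E (qmon n) = D (qmon n).
  suff <- : E = D by [].
  by apply: der_ext; apply: qmon_ext EE; exact: der_linear.
suff [E PE EE] : exists2 E : der Cq, P E & forall n, E (qmon n) =
    \sum_(s <- S) qcoef (s + n) (D (qmon n)) *: qmon (s + n).
  by exists E => // n; rewrite EE -DE.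
elim: {DE}(S : seq _) => [|s T [E PE EE]].
  by exists 0 => // n; rewrite big_nil der0.
suff [G PG GE] : exists2 G : der Cq, P G & forall n, G (qmon n) =
    qcoef (s + n) (D (qmon n)) *: qmon (s + n).
  exists (G + E); first exact: PD.
  by move=> n; rewrite derD GE EE big_cons.
case: (pselect (in_rad q s)) => rs.
  pose u : 'rV[C]_d := \row_i (qcoef (s + delta_mx 0 i) (D (qmon (delta_mx 0 i)))
    / sigma s (delta_mx 0 i)).
  exists (Dur u rs); first exact: Pu.
  move=> n; rewrite Dur_qmon (der_coef_rad D rs); congr (_ * _ *: _).
  by apply: eq_bigr => i _; rewrite !mxE.
have [m sm] : exists m, sigma s m - sigma m s != 0.
  apply: contrapT => h; apply/rs/in_radE => m; apply: contrapT => smE.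
  by apply: h; exists m; rewrite subr_eq0; apply/eqP.
exists ((qcoef (s + m) (D (qmon m)) / (sigma s m - sigma m s)) *: ad (qmon s)).
  exact/PZ/Ps.
move=> n; rewrite derZ ad_qmon scalerA mulrAC -(der_coefC D n m).
by rewrite mulfK.
Qed.

End DerSpan.

(* V (x) C_q, realised as the finitely supported functions Z^d -> V. *)
Definition tensq (C : fieldType) (d : nat) (V : lmodType C) : Type :=
  fsupp 'rV[int]_d V.

HB.instance Definition _ (C : fieldType) (d : nat) (V : lmodType C) :=
  GRing.Lmodule.on (tensq d V).

(* v(n) = v (x) t^n *)
Definition tens (C : fieldType) (d : nat) (V : lmodType C)
    (v : V) (n : 'rV[int]_d) : tensq d V := fsdelta v n.

Lemma tens_linear (C : fieldType) (d : nat) (V : lmodType C) n :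
  linear (fun v : V => tens v n : tensq d V).
Proof. exact: fsdelta_linear. Qed.

Lemma tens_ext (C : fieldType) (d : nat) (V W : lmodType C)
    (f g : tensq d V -> W) : linear f -> linear g ->
  (forall v n, f (tens v n) = g (tens v n)) -> f =1 g.
Proof. exact: linear_fs_ext. Qed.

(* [F] is the action of g on V (x) C_q making it F^alpha(V).  The derivations
   below span Der(C_q) (der_spanned), so there is at most one such [F]
   (Falpha_unique). *)
Record is_Falpha (C : fieldType) (d : nat) (q : quantum_matrix C d)
    (alpha : 'rV[C]_d) (V : lmodType C) (rho : 'M[C]_d -> V -> V)
    (F : qalg q -> tensq d V -> tensq d V) : Prop := IsFalpha {
  Falpha_module : lie_module (@sd_br C (qtorus q)) F;
  Falpha_ad : forall s v n, ~ in_rad q s ->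
    F (of_der (ad (qmon q s))) (tens v n) =
      (sigma q s n - sigma q n s) *: tens v (n + s);
  Falpha_D : forall u r (rr : in_rad q r) v n,
    F (of_der (Dur u rr)) (tens v n) =
      sigma q r n *:
        tens (dot u (intv C n + alpha) *: v + rho ((intv C r)^T *m u) v) (r + n);
  Falpha_t : forall m v n,
    F (torus1 (qmon q m)) (tens v n) = sigma q m n *: tens v (m + n) }.

Lemma Falpha_unique (C : fieldType) (d : nat) (q : quantum_matrix C d)
    (alpha : 'rV[C]_d) (V : lmodType C) (rho : 'M[C]_d -> V -> V)
    (F G : qalg q -> tensq d V -> tensq d V) :
  is_Falpha alpha rho F -> is_Falpha alpha rho G -> forall x w, F x w = G x w.
Proof.
move=> hF hG; have [Fr Fl _] := Falpha_module hF; have [Gr Gl _] := Falpha_module hG.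
have FD x y w : F (x + y) w = F x w + F y w by rewrite -[x]scale1r Fl !scale1r.
have GD x y w : G (x + y) w = G x w + G y w by rewrite -[x]scale1r Gl !scale1r.
have F0 w : F 0 w = 0 by apply: (addrI (F 0 w)); rewrite -FD !addr0.
have G0 w : G 0 w = 0 by apply: (addrI (G 0 w)); rewrite -GD !addr0.
have FZ a x w : F (a *: x) w = a *: F x w by rewrite -[a *: x]addr0 Fl F0 addr0.
have GZ a x w : G (a *: x) w = a *: G x w by rewrite -[a *: x]addr0 Gl G0 addr0.
move=> [D a] w.
have -> : (D, a) = of_der D + torus1 a by congr pair; rewrite ?addr0 ?add0r.
rewrite FD GD; congr (_ + _).
  move: D w; apply: der_spanned.
  - by move=> w; rewrite F0 G0.
  - move=> D E DE EE w; have -> : of_der (D + E) = of_der D + of_der E.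
      by congr pair; rewrite addr0.
    by rewrite FD GD DE EE.
  - move=> b D DE w; have -> : of_der (b *: D) = b *: of_der D.
      by congr pair; rewrite scaler0.
    by rewrite FZ GZ DE.
  - move=> u r rr; apply: tens_ext => // v n.
    by rewrite (Falpha_D hF) (Falpha_D hG).
  - move=> s rs; apply: tens_ext => // v n.
    by rewrite (Falpha_ad hF) // (Falpha_ad hG).
move: a; apply: qmon_ext => [b x y|b x y|m].
- have -> : torus1 (b *: x + y) = b *: torus1 x + torus1 y.
    by congr pair => /=; rewrite ?scaler0 ?addr0.
  by rewrite Fl.
- have -> : torus1 (b *: x + y) = b *: torus1 x + torus1 y.
    by congr pair => /=; rewrite ?scaler0 ?addr0.
  by rewrite Gl.
move: w; apply: tens_ext => // v n.
by rewrite (Falpha_t hF) (Falpha_t hG).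
Qed.

(* Main.v *)
(* Write T(n) for the action of t^n.  The two associativity hypotheses make V' a
   bimodule over C_q, with t^n acting on the right as R(n) = T(n) - ad t^n.  The
   operators T(n)^-1 R(n) have degree 0 and form a representation of the finite
   group Z^d / rad(f); since f is nondegenerate on that group, averaging
   against its characters f(m, .) gives a nonzero weight vector on which all
   ad t^n vanish.  Let W be the space of such vectors in one weight space.  By
   irreducibility V' is the direct sum of the T(n) W, and V' is determined by
   the operators X(u, r) = T(r)^-1 D(u, r) on W, which satisfy
     [X(u, r), X(v, s)] =
        (u, s) (X(v, r + s) - X(v, s)) - (v, r) (X(u, r + s) - X(u, r)).
   These are the relations of the vector fields z^r D_u near the point z = 1,
   so k-fold differences of X(u, .) correspond to fields vanishing to order k
   there.  On the finite dimensional W the fields vanishing to a high order act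
   as 0; the Euler field E has [E, x] = (k - 1) x modulo order k + 1 for a field
   x vanishing to order k, so by irreducibility all those vanishing to order 2
   act as 0.  Hence r |-> X(u, r) - X(u, 0) is additive, and it comes from an
   action of gl_d on W. *)

Require Import Defs.
From HB Require Import structures.
From mathcomp Require Import all_boot all_order all_algebra.
From mathcomp Require Import finmap zify ring.
From mathcomp.multinomials Require Import monalg.
From mathcomp Require Import boolp functions.
From mathcomp Require Import reals.
From mathcomp.real_closed Require Import complex.

Set Implicit Arguments.
Unset Strict Implicit.
Unset Printing Implicit Defensive.

Import Order.TTheory GRing.Theory Num.Theory.
Local Open Scope ring_scope.

(** * Finite differences *)

Section Differences.
Variables (C : fieldType) (G : zmodType).

Definition dif (M : zmodType) (s : G) (h : G -> M) (p : G) : M :=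
  h (p + s) - h p.

Fixpoint difs (M : zmodType) (l : seq G) (h : G -> M) : G -> M :=
  if l is s :: l' then difs l' (dif s h) else h.

(** These are the polynomial maps on [G] of degree less than [k]; for [k = 0], only the zero map. *)
Definition vanishing (M : zmodType) (k : nat) (h : G -> M) : Prop :=
  forall l p, size l = k -> difs l h p = 0.

Lemma eq_difs (M : zmodType) l (g h : G -> M) p :
  g =1 h -> difs l g p = difs l h p.
Proof. by move=> /funext ->. Qed.

Lemma difs_morph (M M' : zmodType) (f : M -> M') l (h : G -> M) p :
  {morph f : x y / x - y} -> difs l (fun x => f (h x)) p = f (difs l h p).
Proof.
move=> fB; elim: l h => //= s l IHl h; rewrite -IHl.
by apply: eq_difs => x; rewrite /dif fB.
Qed.

Lemma difs_shift (M : zmodType) l (h : G -> M) s p :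
  difs l (fun x => h (x + s)) p = difs l h (p + s).
Proof.
elim: l h => //= t l IHl h; rewrite -IHl.
by apply: eq_difs => x; rewrite /dif addrAC.
Qed.

Lemma difsD (M : zmodType) l (g h : G -> M) p :
  difs l (fun x => g x + h x) p = difs l g p + difs l h p.
Proof.
elim: l g h => //= s l IHl g h; rewrite -IHl.
by apply: eq_difs => x; rewrite /dif opprD addrACA.
Qed.

Lemma difsN (M : zmodType) l (h : G -> M) p :
  difs l (fun x => - h x) p = - difs l h p.
Proof. by rewrite difs_morph // => x y; rewrite opprD. Qed.

Lemma difs0 (M : zmodType) l p : difs l (fun=> 0 : M) p = 0.
Proof.
by rewrite (@difs_morph _ _ (fun=> 0) l (fun=> 0 : M)) // => x y; rewrite subr0.
Qed.

Lemma difs_cst (M : zmodType) l (c : M) p :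
  (0 < size l)%N -> difs l (fun=> c) p = 0.
Proof.
case: l => //= s l _; rewrite -[RHS](difs0 M l p).
by apply: eq_difs => x; rewrite /dif subrr.
Qed.

Lemma difs_dif (M : zmodType) l s (h : G -> M) p :
  difs l (dif s h) p = difs l h (p + s) - difs l h p.
Proof. by rewrite difsD difs_shift difsN. Qed.

Lemma difsZ (M : lmodType C) l a (h : G -> M) p :
  difs l (fun x => a *: h x) p = a *: difs l h p.
Proof. by rewrite difs_morph // => x y; rewrite scalerBr. Qed.

Lemma difs_sum (M : zmodType) (I : Type) (r : seq I) l (h : I -> G -> M) p :
  difs l (fun x => \sum_(i <- r) h i x) p = \sum_(i <- r) difs l (h i) p.
Proof.
elim: r => [|i r IHr].
  rewrite big_nil -[RHS](difs0 M l p).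
  by apply: eq_difs => x; rewrite big_nil.
rewrite big_cons -IHr -difsD.
by apply: eq_difs => x; rewrite big_cons.
Qed.

Lemma difC (M : zmodType) r s (h : G -> M) p : dif r (dif s h) p = dif s (dif r h) p.
Proof. by rewrite /dif [p + r + s]addrAC !opprB addrACA [- _ - _]addrC addrACA. Qed.

Lemma vanishingS (M : zmodType) k (h : G -> M) :
  vanishing k.+1 h <-> forall s, vanishing k (dif s h).
Proof.
split=> [hk s l p lk|hk [//|s l] p [lk]]; last exact: hk.
by apply: (hk (s :: l)); rewrite /= lk.
Qed.

Lemma vanishing_le (M : zmodType) j k (h : G -> M) :
  (j <= k)%N -> vanishing j h -> vanishing k h.
Proof.
move=> /subnK <-; elim: (k - j)%N => // i IHi hj; apply/vanishingS => s l p lk.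
by rewrite difs_dif !IHi // subrr.
Qed.

(** The two values differ by a difference of order [k.+1]. *)
Lemma vanishing_cst (M : zmodType) k (h : G -> M) l p q :
  vanishing k.+1 h -> size l = k -> difs l h p = difs l h q.
Proof.
move=> hk lk; have -> : p = q + (p - q) by rewrite addrC subrK.
apply/eqP; rewrite -subr_eq0 -difs_dif.
by apply/eqP/(hk (_ :: l)); rewrite /= lk.
Qed.

(** * Differences of a product with an additive function *)

Section Leibniz.
Variables (M : lmodType C) (b : G -> C).
Hypothesis bD : {morph b : x y / x + y}.
Implicit Type h : G -> M.

Lemma dif_mul h s p : dif s (fun x => b x *: h x) p =
  b p *: dif s h p + b s *: h (p + s).
Proof. by rewrite /dif bD scalerDl scalerBr addrAC. Qed.

(** The first differences of [b] are constant, so the Leibniz formula stops after two terms. *)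
Lemma difs_nseq_mul r k h p : difs (nseq k.+1 r) (fun x => b x *: h x) p =
  b p *: difs (nseq k.+1 r) h p + (k.+1%:R * b r) *: difs (nseq k r) h (p + r).
Proof.
elim: k h => [|k IHk] h; first by rewrite /= dif_mul mul1r.
transitivity (difs (nseq k.+1 r) (fun x => b x *: dif r h x + b r *: h (x + r)) p).
  by apply: (eq_difs (nseq k.+1 r)) => x; rewrite dif_mul.
rewrite difsD IHk difsZ (difs_shift (nseq k.+1 r)) /= -addrA -scalerDl.
by rewrite [k.+2%:R]mulrS mulrDl mul1r [b r + _]addrC.
Qed.

(** Multiplication by [b] raises the degree by one and [dif r] lowers it by one. Hence each [k]-fold
    difference of the product is a combination of [k]-fold differences of [h]. *)
Lemma difs_mul_closed (Q : M -> Prop) k r h :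
  (forall x y, Q x -> Q y -> Q (x + y)) -> (forall a x, Q x -> Q (a *: x)) ->
  (forall l p, size l = k -> Q (difs l h p)) ->
  forall l p, size l = k -> Q (difs l (fun x => b x *: dif r h x) p).
Proof.
move=> QD QZ; have QB x y : Q x -> Q y -> Q (x - y).
  by move=> Qx Qy; rewrite -scaleN1r; apply/QD/QZ.
elim: k h => [|k IHk] h Qh [|s l] // p lk.
  by apply/QZ/QB; apply: (Qh [::]).
case: lk => lk.
have -> : difs (s :: l) (fun x => b x *: dif r h x) p =
   difs l (fun x => b x *: dif r (dif s h) x) p + b s *: difs (r :: l) h (p + s).
  rewrite /= -difs_shift -difsZ -difsD; apply: eq_difs => x.
  by rewrite dif_mul difC.
apply: QD; last by apply/QZ/Qh; rewrite /= lk.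
by apply: IHk => // l' p' lk'; apply: (Qh (s :: l')); rewrite /= lk'.
Qed.

End Leibniz.
End Differences.

(** * Polynomial maps on a finitely generated group *)

Section GeneratingFamily.
Variables (G M : zmodType) (gens : seq G).
Hypothesis gensP : forall P : G -> Prop, P 0 ->
  (forall s t, P s -> P t -> P (s + t)) -> (forall s, P s -> P (- s)) ->
  {in gens, forall g, P g} -> forall s, P s.
Implicit Type h : G -> M.

(** Since [dif (s + t) h p = dif s h (p + t) + dif t h p], the [s] for which [dif s h] vanishes to
    order [k] form a subgroup. *)
Lemma vanishing_gens k h :
  {in gens, forall g, vanishing k (dif g h)} -> vanishing k.+1 h.
Proof.
move=> hk; apply/vanishingS; apply: gensP hk => [l p _|s t hs ht l p lk|s hs l p lk].
- by rewrite difs_dif addr0 subrr.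
- transitivity (difs l (dif s h) (p + t) + difs l (dif t h) p).
    by rewrite !difs_dif [s + t]addrC addrA addrA subrK.
  by rewrite hs // ht // addr0.
have := hs l (p - s) lk; rewrite !difs_dif subrK => /eqP.
by rewrite subr_eq0 => /eqP ->; rewrite subrr.
Qed.

(* The bound is [(\sum_g K g).+1] and not [\sum_g K g], so as to be correct for
   the trivial group generated by the empty family. *)
Lemma nilpotent_vanishing (K : G -> nat) h :
  {in gens, forall g p, difs (nseq (K g) g) h p = 0} ->
  vanishing (\sum_(g <- gens) K g).+1 h.
Proof.
move Em: (\sum_(g <- gens) K g)%N => m; have {Em}: (\sum_(g <- gens) K g <= m)%N.
  by rewrite Em.
elim: m K h => [|m IHm] K h sK hK; apply: vanishing_gens => g gg.
  have Kg : K g = 0%N.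
    by apply/eqP; move: sK; rewrite leqn0 sum_nat_seq_eq0 => /allP/(_ _ gg).
  have h0 p : h p = 0 by move: (hK g gg p); rewrite Kg.
  by move=> [|//] p _; rewrite /= /dif !h0 subrr.
have [Kg|] := posnP (K g).
  have h0 p : h p = 0 by move: (hK g gg p); rewrite Kg.
  move=> l p _; rewrite -[RHS](difs0 M l p).
  by apply: eq_difs => x; rewrite /dif !h0 subrr.
case EK: (K g) => [//|k] _.
(* Passing from [h] to [dif g h] lowers the exponent at [g] by one and raises no other, so the sum
   drops. *)
apply: (IHm (fun t => if t == g then k else K t)) => [|t tg p].
  rewrite -ltnS (leq_trans _ sK) // !(big_rem g gg) /= eqxx EK addSn ltnS leq_add2l.
  by apply: leq_sum => t _; case: eqP => // ->; rewrite EK.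
case: eqP => [->|_]; last by rewrite difs_dif !hK // subrr.
by have := hK g gg p; rewrite EK.
Qed.

End GeneratingFamily.

(** * Eigenvalues along arithmetic progressions *)

Section FiniteSpectrum.
Variable C : numClosedFieldType.

(** There are finitely many roots, and in characteristic 0 each of them is met by at most one
    [j]. *)
Lemma eventually_not_root (p : {poly C}) (c : C) (m : nat) :
  p != 0 -> (0 < m)%N ->
  exists K, forall j, (K <= j)%N -> ~~ root p (c + (j * m)%:R).
Proof.
move=> p0 m0; have [rs pE] := closed_field_poly_normal p.
have {pE} rE x : root p x = (x \in rs).
  by rewrite pE rootZ ?lead_coef_eq0 // root_prod_XsubC.
suff [K KP] : exists K, forall j, (K <= j)%N -> c + (j * m)%:R \notin rs.
  by exists K => j /KP; rewrite rE.
elim: {rE} rs => [|r rs [K KP]]; first by exists 0%N.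
case: (pselect (exists j, c + (j * m)%:R = r)) => [[i <-]|nr].
  exists (maxn K i.+1) => j; rewrite geq_max => /andP[Kj ij].
  rewrite inE negb_or KP // andbT (inj_eq (addrI c)) eqr_nat eqn_pmul2r //.
  by rewrite gtn_eqF.
exists K => j Kj; rewrite inE negb_or KP // andbT.
by apply/eqP => jr; apply: nr; exists j.
Qed.

(** Starting from an eigenvalue [c], [lam] is the last eigenvalue among [c], [c + m], [c + 2m] and
    so on. The transpose is there because [eigenvalue] concerns row vectors. *)
Lemma eigenvector_top n (E : 'M[C]_n) (m : nat) : (0 < n)%N -> (0 < m)%N ->
  exists lam (w : 'cV_n), [/\ w != 0, E *m w = lam *: w &
    forall w' : 'cV_n, E *m w' = (lam + m%:R) *: w' -> w' = 0].
Proof.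
move=> n0 m0; have pE : char_poly E^T != 0 by rewrite monic_neq0 ?char_poly_monic.
have [c rc] : exists c, root (char_poly E^T) c.
  by apply/closed_rootP; rewrite size_char_poly eqSS -lt0n.
have [K KP] := eventually_not_root c pE m0.
pose P j := root (char_poly E^T) (c + (j * m)%:R).
have P0 : exists j, P j by exists 0%N; rewrite /P mul0n addr0.
have Pb j : P j -> (j <= K)%N.
  by apply: contraLR; rewrite -ltnNge => /ltnW /KP.
case: (ex_maxnP P0 Pb) => j Pj jmax.
have /eigenvalueP[v vE v0] : eigenvalue E^T (c + (j * m)%:R).
  by rewrite eigenvalue_root_char.
exists (c + (j * m)%:R), v^T; split; first by rewrite trmx_eq0.
  by rewrite -[E]trmxK -trmx_mul vE linearZ.
move=> w wE; apply: contraTeq isT => w0 /=.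
suff /jmax : P j.+1 by rewrite ltnn.
rewrite /P -eigenvalue_root_char; apply/eigenvalueP; exists w^T.
  by rewrite -trmx_mul wE linearZ mulSn [(m + _)%N]addnC natrD addrA.
by rewrite trmx_eq0.
Qed.

(** The map [ad E] acts on the finite dimensional space of matrices, so only finitely many integers
    are eigenvalues of it. *)
Lemma ad_eigenvector_eq0 n (E : 'M[C]_n) :
  exists K, forall k (A : 'M_n), (K <= k)%N ->
    E *m A - A *m E = k%:R *: A -> A = 0.
Proof.
pose adE := (mulmx E \- mulmxr E).
have p0 : char_poly (lin_mx adE) != 0 by rewrite monic_neq0 ?char_poly_monic.
have [K KP] := eventually_not_root 0 p0 (ltnSn 0).
exists K => k A /KP; rewrite muln1 add0r -eigenvalue_root_char => nk AE.
apply: contraNeq nk => A0; apply/eigenvalueP; exists (mxvec A).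
  by rewrite mul_vec_lin /= AE linearZ.
by rewrite mxvec_eq0.
Qed.

End FiniteSpectrum.

(** * Finite dimensional representations of the relation *)

Section Relation.
(** In the application [G] is rad(f), [b u r] is (u, r), and [A] is the algebra of matrices acting
    on the space W of vectors of one weight killed by all ad t^n. *)
Variables (C : numFieldType) (G : zmodType) (U : lmodType C) (A : algType C).
Variables (b : U -> G -> C) (X : U -> G -> A).
Hypothesis bD : forall u, {morph b u : r s / r + s}.
Hypothesis X_linear : forall r, linear (X^~ r).
Hypothesis ad_eigenvector : forall E : A, exists K, forall k (x : A),
  (K <= k)%N -> E * x - x * E = k%:R *: x -> x = 0.
Hypothesis XR : forall u v r s, X u r * X v s - X v s * X u r =
  b u s *: (X v (r + s) - X v s) - b v r *: (X u (r + s) - X u r).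

Let b0 u : b u 0 = 0.
Proof. by apply: (addrI (b u 0)); rewrite -bD !addr0. Qed.
Let bN u r : b u (- r) = - b u r.
Proof. by apply: (addrI (b u r)); rewrite -bD !subrr b0. Qed.

Let XD u v r : X (u + v) r = X u r + X v r.
Proof. by have := X_linear r 1 u v; rewrite !scale1r. Qed.
Let X0 r : X 0 r = 0.
Proof. by apply: (addrI (X 0 r)); rewrite -XD !addr0. Qed.
Let XZ a u r : X (a *: u) r = a *: X u r.
Proof. by have := X_linear r a u 0; rewrite X0 !addr0. Qed.

(* For E = -X(u, -r), the differences (dif r)^(k+1) X(u, .) (-r) are eigenvectors
   of ad E with eigenvalue k: they are the fields (z - 1)^(k+1) d/dz in the
   coordinate z along r, and E is (z - 1) d/dz up to the central X(u, 0). *)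
Lemma difs_line_eq0 u r : b u r = 1 -> exists K, forall k i, (K <= k)%N ->
  difs (nseq k r) (X u) (r *+ i) = 0.
Proof.
move=> ur; pose E := - X u (- r).
have [K KP] := ad_eigenvector E; exists K.+1.
suff e0 k i : (K < k)%N -> difs (nseq k r) (X u) (r *+ i - r) = 0.
  by move=> k i /(e0 k i.+1); rewrite mulrSr addrK.
(* A difference of order [k.+1] is the increment along [r] of the one of order [k], so vanishing at
   [- r] in all high orders propagates to the next multiples of [r]. *)
move=> Kk; elim: i k Kk => [|i IHi] k Kk; last first.
  have := IHi k.+1 (ltnW Kk); rewrite /= difs_dif IHi // subr0 => <-.
  by rewrite subrK mulrSr addrK.
case: k Kk => // k Kk; rewrite mulr0n sub0r; apply: (KP k) => //.
have EX p : E * X u p - X u p * E =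
    b u p *: dif r (X u) (p - r) + (- X u (p - r) + X u (- r)).
  rewrite /E mulNr mulrN -opprD XR bN ur scaleN1r opprK [- r + p]addrC opprD.
  by rewrite -scalerN /dif subrK !opprB [X u (- r) - _]addrC.
transitivity (difs (nseq k.+1 r) (fun p => E * X u p - X u p * E) (- r)).
  rewrite (@difs_morph _ _ _ (fun x => E * x - x * E)) // => x y.
  by rewrite mulrBr mulrBl !opprB addrACA [- _ - _]addrC addrACA.
rewrite (eq_difs _ _ EX) difsD difsD difs_cst // addr0 difsN.
rewrite (difs_nseq_mul (bD u)) bN ur mulr1 scaleN1r.
rewrite !(difs_shift _ _ (- r)) difs_dif subrK addNr sub0r.
have -> : difs (nseq k r) (dif r (X u)) (- r) = difs (nseq k.+1 r) (X u) (- r) by [].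
by rewrite opprB mulrS scalerDl scale1r addrA subrK addrAC subrr add0r.
Qed.

(* Differencing the relation for [X(u, p), X(v, s)] in p, at p = 0 for the pair
   (0, s) and at p = r for the pair (r, s - r), and subtracting, gives
   (dif r)^k X(v, .) = - (v, r) (dif r)^k X(u, .); the case v = u ends it. *)
Lemma difs_eq0 u r : b u r = 1 -> exists K, forall v s,
  difs (nseq K r) (X v) s = 0.
Proof.
move=> ur; have [K KP] := difs_line_eq0 ur; exists K.+2.
have RE v s p : X u p * X v s - X v s * X u p = b u s *: (X v (p + s) - X v s)
    - b v p *: (X u (p + s) - X u p) by exact: XR.
pose k := K.+1.
(* The commutator and the terms in [X u] at multiples of [r] disappear by [difs_line_eq0]; the
   Leibniz rule for [b v] leaves two terms. *)
have key v s i : b u s *: difs (nseq k.+1 r) (X v) (r *+ i + s) =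
   b v (r *+ i) *: difs (nseq k.+1 r) (X u) (r *+ i + s) +
   (k.+1%:R * b v r) *: difs (nseq k r) (X u) (r *+ i.+1 + s).
  have : difs (nseq k.+1 r) (fun p => X u p * X v s - X v s * X u p) (r *+ i) = 0.
    rewrite (@difs_morph _ _ _ (fun x => x * X v s - X v s * x)).
      by rewrite KP ?mul0r ?mulr0 ?subrr // ltnW // ltnW.
    by move=> x y; rewrite mulrBl mulrBr !opprB addrACA [- _ - _]addrC addrACA.
  rewrite (eq_difs _ _ (RE v s)) difsD difsN difsZ difsD difs_cst // addr0 difs_shift.
  move/eqP; rewrite subr_eq0 => /eqP ->.
  rewrite (difs_nseq_mul (bD v)) !difsD !difs_shift !difsN.
  by rewrite -mulrSr !KP ?subr0 // ltnW // ltnW.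
have vu v s : difs (nseq k.+1 r) (X v) s = - (b v r *: difs (nseq k.+1 r) (X u) s).
  have := key v (s - r) 1%N; have := key v s 0%N.
  have -> : r *+ 2 + (s - r) = r *+ 1 + s by rewrite mulrSr addrACA subrr addr0.
  rewrite mulr0n b0 scale0r !add0r mulr1n [r + (s - r)]addrC subrK bD bN ur => e0.
  by rewrite scalerBl scale1r e0 addrC => /addIr <-; rewrite opprK.
have u0 s : difs (nseq k.+1 r) (X u) s = 0.
  have := vu u s; rewrite ur scale1r => /eqP.
  by rewrite -addr_eq0 -mulr2n -scaler_nat scaler_eq0 pnatr_eq0 => /eqP.
by move=> v s; rewrite vu u0 scaler0 oppr0.
Qed.

Hypothesis b_nondegenerate : forall r, r != 0 -> exists u, b u r = 1.
Variable gens : seq G.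
Hypothesis gensP : forall P : G -> Prop, P 0 ->
  (forall s t, P s -> P t -> P (s + t)) -> (forall s, P s -> P (- s)) ->
  {in gens, forall g, P g} -> forall s, P s.

(** Along each generator some iterated difference kills all [X v] at once. For [r] nonzero this is
    [difs_eq0] with a [u] such that [b u r = 1]. *)
Lemma vanishing_all : exists k, forall v, vanishing k (X v).
Proof.
have nil r : exists K, forall v s, difs (nseq K r) (X v) s = 0.
  have [->|/b_nondegenerate[u /difs_eq0 //]] := eqVneq r 0.
  by exists 1%N => v s; rewrite /= /dif addr0 subrr.
have [K KP] := choice nil.
by exists (\sum_(g <- gens) K g).+1 => v; apply: (nilpotent_vanishing gensP) => g _ p.
Qed.

(** Dual families for the pairing [b]. As [dual_r] is tested on additive maps into a vector space,
    the [rs i] may generate a proper subgroup of finite index. *)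
Variables (m : nat) (us : 'I_m -> U) (rs : 'I_m -> G).
Hypothesis dual_l : forall v, \sum_i b v (rs i) *: us i = v.
Hypothesis dual_r : forall c : G -> A, {morph c : r s / r + s} ->
  forall s, \sum_i b (us i) s *: c (rs i) = c s.

(* The operator sum_i b (us i) * dif (rs i) is a discrete Euler operator: it
   multiplies a homogeneous polynomial function by its degree. *)
Lemma difs_euler k l (h : G -> A) p : vanishing k.+1 h -> size l = k ->
  difs l (fun x => \sum_i b (us i) x *: dif (rs i) h x) p = k%:R *: difs l h p.
Proof.
elim: k l h => [|k IHk] [|s l] h //= hk lk.
  rewrite scale0r big1 // => i _.
  by rewrite [dif _ _ _](hk [:: rs i] p) ?scaler0.
case: lk => lk; have hsk := (vanishingS _ _).1 hk.
transitivity (difs l (fun x => \sum_i b (us i) x *: dif (rs i) (dif s h) x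
    + \sum_i b (us i) s *: dif (rs i) h (x + s)) p).
  apply: eq_difs => x; rewrite {1}/dif -big_split -sumrB; apply: eq_bigr => i _ /=.
  by rewrite difC; apply: (dif_mul (bD _) (dif (rs i) h)).
rewrite difsD IHk // difs_sum -[k.+1]addn1 natrD scalerDl scale1r; congr (_ + _).
have cst t q : difs (t :: l) h q = difs (t :: l) h p.
  by apply: (vanishing_cst (l := t :: l) _ _ hk); rewrite /= lk.
(* Differences of top order are constant, so [c] is additive in [t] and [dual_r] applies to it. *)
pose c t := difs (t :: l) h p.
transitivity (\sum_i b (us i) s *: c (rs i)).
  apply: eq_bigr => i _.
  by rewrite difsZ difs_shift -[LHS]/(_ *: difs (rs i :: l) h _) cst.
rewrite dual_r // => t t'; rewrite /c -(cst t (p + t')) /= !difs_dif.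
by rewrite [RHS]addrA subrK -[p + t' + t]addrA [t' + t]addrC.
Qed.

Variables (W : lmodType C) (op : A -> W -> W).
Hypothesis op_linearl : forall w, linear (op^~ w).
Hypothesis op_linearr : forall x, linear (op x).
Hypothesis opM : forall x y w, op (x * y) w = op x (op y w).
Hypothesis op_faithful : forall x, (forall w, op x w = 0) -> x = 0.
Hypothesis op_eigenvector : forall (E : A) (j : nat), (0 < j)%N ->
  exists lam w, [/\ w != 0, op E w = lam *: w &
    forall w', op E w' = (lam + j%:R) *: w' -> w' = 0].
Hypothesis op_irreducible : forall P : W -> Prop, P 0 ->
  (forall v w, P v -> P w -> P (v + w)) -> (forall a w, P w -> P (a *: w)) ->
  (forall u r w, P w -> P (op (X u r) w)) ->
  (forall w, P w -> w = 0) \/ (forall w, P w).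

Let opDl x y w : op (x + y) w = op x w + op y w.
Proof. by have := op_linearl w 1 x y; rewrite !scale1r. Qed.
Let op0l w : op 0 w = 0.
Proof. by apply: (addrI (op 0 w)); rewrite -opDl !addr0. Qed.
Let opZl a x w : op (a *: x) w = a *: op x w.
Proof. by have := op_linearl w a x 0; rewrite op0l !addr0. Qed.
Let opDr x v w : op x (v + w) = op x v + op x w.
Proof. by have := op_linearr x 1 v w; rewrite !scale1r. Qed.
Let op0r x : op x 0 = 0.
Proof. by apply: (addrI (op x 0)); rewrite -opDr !addr0. Qed.
Let opZr a x w : op x (a *: w) = a *: op x w.
Proof. by have := op_linearr x a w 0; rewrite op0r !addr0. Qed.
Let opBl x y w : op (x - y) w = op x w - op y w.
Proof. by apply: (addIr (op y w)); rewrite -opDl !subrK. Qed.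

(* For E = sum_i X(us i, rs i), a k-fold difference c of X(u, .) satisfies
   [E, c] = (k - 1) c, so c kills the lam-eigenvectors of E as soon as
   lam + (k - 1) is not an eigenvalue.  The vectors killed by all such c form
   a submodule. *)
Lemma vanishing_pred k : (1 < k)%N -> (forall u, vanishing k.+1 (X u)) ->
  forall u, vanishing k (X u).
Proof.
case: k => // j j0 Xk.
have cst u l p s : size l = j.+1 -> difs l (X u) (p + s) = difs l (X u) p.
  exact: (vanishing_cst _ _ (Xk u)).
pose E := \sum_i X (us i) (rs i).
have Edifs u l p : size l = j.+1 ->
    E * difs l (X u) p - difs l (X u) p * E = j%:R *: difs l (X u) p.
  move=> lk; rewrite -(@difs_morph _ _ _ (fun x => E * x - x * E)); last first.
    by move=> x y; rewrite mulrBr mulrBl !opprB addrACA [- _ - _]addrC addrACA.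
  transitivity (difs l (fun x => \sum_i b (us i) x *: dif (rs i) (X u) x -
     \sum_i b u (rs i) *: (X (us i) (x + rs i) - X (us i) (rs i))) p).
    apply: eq_difs => x; rewrite mulr_suml mulr_sumr -!sumrB.
    by apply: eq_bigr => i _; rewrite XR [rs i + x]addrC.
  rewrite difsD difsN (@difs_euler j.+1) // difs_sum mulrS scalerDl scale1r.
  (* This second sum lowers the Euler eigenvalue from [j.+1] to [j]: up to terms without effect on
     the differences, it is [X u] by [dual_l]. *)
  suff -> : \sum_i difs l (fun x => b u (rs i) *:
      (X (us i) (x + rs i) - X (us i) (rs i))) p = difs l (X u) p.
    by rewrite addrAC subrr add0r.
  transitivity (difs l (fun x => \sum_i b u (rs i) *: X (us i) x) p).
    rewrite difs_sum; apply: eq_bigr => i _.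
    by rewrite !difsZ difsD difs_shift difs_cst ?lk // addr0 cst.
  apply: eq_difs => x; rewrite -[in RHS](dual_l u).
  rewrite (big_morph (X^~ x) (fun v w => XD v w x) (X0 x)).
  by apply: eq_bigr => i _; rewrite XZ.
pose P w := forall u l p, size l = j.+1 -> op (difs l (X u) p) w = 0.
have [|||u r w Pw v l p lk|P0|PT] := @op_irreducible P.
- by move=> u l p _; rewrite op0r.
- by move=> v w Pv Pw u l p lk; rewrite opDr Pv // Pw // addr0.
- by move=> a w Pw u l p lk; rewrite opZr Pw // scaler0.
(* Stability of [P]: by [XR] the commutator with [X u r] involves a shift of [X u] and the product
   of [b u] with [dif r (X v)], whose differences kill [w] by [difs_mul_closed]. *)
- rewrite -opM -[_ * _](subrK (X u r * difs l (X v) p)) opDl opM Pw // op0r addr0.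
  rewrite -(@difs_morph _ _ _ (fun x => x * X u r - X u r * x)); last first.
    by move=> x y; rewrite mulrBr mulrBl !opprB addrACA [- _ - _]addrC addrACA.
  transitivity (op (difs l (fun x => b v r *: (X u (x + r) - X u r)
     - b u x *: dif r (X v) x) p) w).
    by congr (op _ w); apply: eq_difs => x; rewrite XR.
  rewrite difsD difsN difsZ difsD difs_shift difs_cst ?lk // addr0.
  rewrite opBl opZl Pw // scaler0 sub0r; apply/eqP; rewrite oppr_eq0; apply/eqP.
  apply: (@difs_mul_closed _ _ _ (b u) (bD u) (fun x => op x w = 0) j.+1) => //.
  + by move=> x y xw yw; rewrite opDl xw yw addr0.
  + by move=> a x xw; rewrite opZl xw scaler0.
  + by move=> l' p' lk'; apply: Pw.
- have [lam [w [w0 Ew wtop]]] := op_eigenvector E j0.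
  case/eqP: w0; apply: P0 => u l p lk; apply: wtop.
  rewrite -opM -[_ * _](subrK (difs l (X u) p * E)) Edifs // opDl opM Ew opZr opZl.
  by rewrite -scalerDl addrC.
by move=> u l p lk; apply: op_faithful => w; apply: PT.
Qed.

(** The order given by [vanishing_all] is lowered to 2 by [vanishing_pred]; the identity is then a
    second difference at 0. Starting from [k + 2] keeps every order in the descent above 1. *)
Lemma X_affine u r s : X u (r + s) + X u 0 = X u r + X u s.
Proof.
have [k Xk] := vanishing_all.
suff : vanishing 2 (X u).
  move=> /(_ [:: r; s] 0 erefl); rewrite /= /dif !add0r => /eqP.
  by rewrite opprB addrACA -opprD subr_eq0 [s + r]addrC [X u s + _]addrC => /eqP.
have {Xk} : forall v, vanishing (k + 2) (X v).
  by move=> v; apply: vanishing_le (Xk v); rewrite leq_addr.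
elim: k u => [|k IHk] u Xk; first exact: Xk.
by apply: IHk; apply: vanishing_pred => //; rewrite addn2.
Qed.

End Relation.
(** * The bimodule structure *)

Section Radical.
Variables (C : fieldType) (d : nat) (q : quantum_matrix C d).
Local Notation Zd := 'rV[int]_d.

Lemma in_radD r s : in_rad q r -> in_rad q s -> in_rad q (r + s).
Proof.
move=> /in_radE hr /in_radE hs; apply/in_radE => m.
by rewrite sigmaDl sigmaDr hr hs.
Qed.

Lemma in_radN r : in_rad q r -> in_rad q (- r).
Proof. by move=> /in_radE hr; apply/in_radE => m; rewrite sigmaNl sigmaNr hr. Qed.

Lemma commfDl m m' n : commf q (m + m') n = commf q m n * commf q m' n.
Proof. by rewrite /commf sigmaDl sigmaDr invfM mulrACA. Qed.

Lemma commfDr m n n' : commf q m (n + n') = commf q m n * commf q m n'.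
Proof. by rewrite /commf sigmaDl sigmaDr invfM mulrACA. Qed.

Lemma commf_neq0 m n : commf q m n != 0.
Proof. by rewrite mulf_neq0 ?invr_eq0 ?sigma_neq0. Qed.

Lemma commfV m n : commf q n m = (commf q m n)^-1.
Proof. by rewrite /commf invfM invrK mulrC. Qed.

Lemma commfNl m n : commf q (- m) n = (commf q m n)^-1.
Proof. by rewrite /commf sigmaNl sigmaNr invfM invrK. Qed.

(** [N.+1] is the product of exponents killing the [q i j]; the successor form makes ['I_N.+1] a
    group. *)
Lemma in_rad_multiples : exists N : nat, forall n, in_rad q (n *+ N.+1).
Proof.
have [N HN] : exists N : nat, forall i j, q i j ^+ N.+1 = 1.
  have e_ (p : 'I_d * 'I_d) : exists n : nat, (0 < n)%N /\ q p.1 p.2 ^+ n = 1.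
    by have [n n0 qn] := qmx_root q p.1 p.2; exists n.
  have [e eP] := choice e_.
  have e0 : (0 < \prod_p e p)%N by apply: prodn_gt0 => p; case: (eP p).
  exists (\prod_p e p).-1 => i j; rewrite prednK // (bigD1 (i, j)) //=.
  by rewrite exprM (proj2 (eP (i, j))) expr1n.
exists N => n; apply/in_radE => m.
have qN i j (z : int) : q i j ^ (N.+1%:Z * z) = 1.
  by rewrite -exprz_exp -exprnP HN exp1rz.
have -> : sigma q (n *+ N.+1) m = 1.
  rewrite sigma.unlock; apply: big1 => i _; apply: big1 => j _.
  by rewrite mulmxnE -mulr_natl -mulrA natz qN.
rewrite sigma.unlock; apply: esym; apply: big1 => i _; apply: big1 => j _.
by rewrite mulmxnE -mulr_natl mulrCA natz qN.
Qed.

Lemma qtorus_sum (a : qtorus q) :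
  a = \sum_(k <- msupp a) qcoef k a *: qmon q k.
Proof.
rewrite /qcoef; transitivity (lext (qmon q) a); last by rewrite lext.unlock.
move: a; apply: (@qmon_ext C d q (qtorus q) id (lext (qmon q))) => // [c x y|n].
  exact: linearP.
by rewrite lext_qmon.
Qed.

Lemma der_br_ad (D : der (qtorus q)) a : der_br D (ad a) = ad (D a).
Proof.
apply: der_ext => x /=; rewrite linearB /= !derM opprD opprB.
rewrite (AC ((2*2)*2) ((1*4)*((2*6)*(3*5)))) /=.
by rewrite subrr addNr !addr0.
Qed.

Lemma der_scaler (D : der (qtorus q)) a x : D (a *: x) = a *: D x.
Proof. by rewrite linearZ. Qed.

Lemma Dur_linear r (rr : in_rad q r) : linear (fun u => Dur u rr).
Proof.
move=> a u v; apply: der_ext; apply: qmon_ext => [||n]; try exact: der_linear.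
rewrite derD derZ !Dur_qmon scalerA -scalerDl mulrA -mulrDl; congr (_ * _ *: _).
rewrite /dot mulr_sumr -big_split; apply: eq_bigr => i _ /=.
by rewrite !mxE mulrDl mulrA.
Qed.

Lemma der_br_Dur u v r s (rr : in_rad q r) (ss : in_rad q s)
    (rs : in_rad q (r + s)) :
  der_br (Dur u rr) (Dur v ss) =
  sigma q r s *: Dur (dot u (intv C s) *: v - dot v (intv C r) *: u) rs.
Proof.
apply: der_ext; apply: qmon_ext => [||n]; try exact: der_linear.
rewrite derZ -[der_br _ _ _]/(Dur u rr (Dur v ss _) - Dur v ss (Dur u rr _)).
rewrite !Dur_qmon !der_scaler !Dur_qmon !scalerA addrA [s + (r + n)]addrA [s + r]addrC.
rewrite -scalerBl; congr (_ *: _).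
have -> : dot (dot u (intv C s) *: v - dot v (intv C r) *: u) (intv C n) =
    dot u (intv C s) * dot v (intv C n) - dot v (intv C r) * dot u (intv C n).
  rewrite /dot !mulr_sumr -sumrB; apply: eq_bigr => i _.
  by rewrite !mxE mulrBl !mulrA.
rewrite !intvD !dotDr !sigmaDl !sigmaDr -((in_radE q r).1 rr s).
by ring.
Qed.

End Radical.

(** * Representatives of Z^d modulo N + 1 *)

Section Box.
Variables (d N : nat).
Local Notation Zd := 'rV[int]_d.

Definition box_int (x : 'rV['I_N.+1]_d) : Zd :=
  map_mx (fun i : 'I_N.+1 => (i : nat)%:Z) x.

Lemma box_intP (n : Zd) : exists x (z : Zd), n = box_int x + z *+ N.+1.
Proof.
exists (\row_(i < d) inord (absz (modz (n 0 i) N.+1))),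
  (\row_(i < d) divz (n 0 i) N.+1).
apply/rowP => i; rewrite !mxE mulmxnE mxE inordK; last first.
  by have := ltz_pmod (n 0 i) (isT : 0 < N.+1%:Z); lia.
rewrite {1}(divz_eq (n 0 i) N.+1) addrC -mulr_natr natz; congr (_ + _).
by have := modz_ge0 (n 0 i) (isT : N.+1%:Z != 0); lia.
Qed.

Lemma box_int0 : box_int 0 = 0.
Proof. by apply/rowP => i; rewrite !mxE. Qed.

Lemma box_intD x y : exists z, box_int (x + y) = box_int x + box_int y + z *+ N.+1.
Proof.
exists (\row_(i < d) - (divn (addn (x 0 i) (y 0 i)) N.+1)%:Z); apply/rowP => i.
rewrite !mxE mulmxnE !mxE /= -mulr_natr natz.
have := divn_eq (x 0 i + y 0 i) N.+1; lia.
Qed.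

(** The map [g] lives on the quotient by the multiples of [N.+1], where translation by [k] is a
    bijection. *)
Lemma sum_box (V : zmodType) (g : Zd -> V) (k : Zd) :
  (forall n z, g (n + z *+ N.+1) = g n) ->
  \sum_x g (box_int x + k) = \sum_x g (box_int x).
Proof.
move=> gN; have [y [z ->]] := box_intP k.
rewrite [RHS](reindex_inj (addIr y)); apply: eq_bigr => x _ /=.
by have [t ->] := box_intD x y; rewrite addrA !gN.
Qed.

End Box.

(** * Left and right actions of C_q *)

Section Bimodule.
Variables (C : numFieldType) (d : nat) (q : quantum_matrix C d).
Variables (V : lmodType C) (act : qalg q -> V -> V).
Hypothesis Hmod : lie_module (@sd_br C (qtorus q)) act.
Local Notation Zd := 'rV[int]_d.
Local Notation sigma := (sigma q).
Local Notation qmon := (qmon q).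
Local Notation T n v := (act (torus1 (qmon n)) v).
Local Notation A D v := (act (of_der D) v).

Lemma actDr x v w : act x (v + w) = act x v + act x w.
Proof. by have := lie_act_linearr Hmod x 1 v w; rewrite !scale1r. Qed.
Lemma act0r x : act x 0 = 0.
Proof. by apply: (addrI (act x 0)); rewrite -actDr !addr0. Qed.
Lemma actZr x a v : act x (a *: v) = a *: act x v.
Proof. by have := lie_act_linearr Hmod x a v 0; rewrite act0r !addr0. Qed.
Lemma actDl x y v : act (x + y) v = act x v + act y v.
Proof. by have := lie_act_linearl Hmod v 1 x y; rewrite !scale1r. Qed.
Lemma act0l v : act 0 v = 0.
Proof. by apply: (addrI (act 0 v)); rewrite -actDl !addr0. Qed.
Lemma actZl a x v : act (a *: x) v = a *: act x v.
Proof. by have := lie_act_linearl Hmod v a x 0; rewrite act0l !addr0. Qed.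
Lemma actBl x y v : act (x - y) v = act x v - act y v.
Proof. by apply: (addIr (act y v)); rewrite -actDl !subrK. Qed.
Lemma actBr x v w : act x (v - w) = act x v - act x w.
Proof. by apply: (addIr (act x w)); rewrite -actDr !subrK. Qed.
Lemma act_sumr x (I : Type) (r : seq I) (F : I -> V) :
  act x (\sum_(i <- r) F i) = \sum_(i <- r) act x (F i).
Proof. exact: (big_morph (act x) (actDr x) (act0r x)). Qed.

Lemma torus1Z a (x : qtorus q) : torus1 (a *: x) = a *: torus1 x.
Proof. by congr pair; rewrite scaler0. Qed.
Lemma torus1D (x y : qtorus q) : torus1 (x + y) = torus1 x + torus1 y.
Proof. by congr pair; rewrite addr0. Qed.
Lemma of_derZ a (D : der (qtorus q)) : of_der (a *: D) = a *: of_der D.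
Proof. by congr pair; rewrite scaler0. Qed.
Lemma of_derD (D E : der (qtorus q)) : of_der (D + E) = of_der D + of_der E.
Proof. by congr pair; rewrite addr0. Qed.

Lemma act_der_torus D a v :
  A D (act (torus1 a) v) = act (torus1 a) (A D v) + act (torus1 (D a)) v.
Proof.
apply/eqP; rewrite addrC -subr_eq -(lie_act_br Hmod); apply/eqP.
congr (act _ v); congr pair => /=.
  by apply: der_ext => x; apply: (etrans (subr0 (D 0))); rewrite linear0.
by rewrite -[0 0]/(0 : qtorus q) subr0 mul0r mulr0 subr0 addr0.
Qed.

Lemma act_der_der D E v : A D (A E v) = A E (A D v) + A (der_br D E) v.
Proof.
apply/eqP; rewrite addrC -subr_eq -(lie_act_br Hmod); apply/eqP.
congr (act _ v); congr pair => /=.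
by rewrite !linear0 mulr0 subrr !addr0.
Qed.

Lemma act_der_ad D n v : A D (A (ad (qmon n)) v) =
  A (ad (qmon n)) (A D v) + A (ad (D (qmon n))) v.
Proof. by rewrite act_der_der der_br_ad. Qed.

Hypothesis Hassoc : torus1_associative act.
Hypothesis Hanti : torus2_antiassociative act.
Hypothesis Hunit : forall v : V, T 0 v = v.

Lemma torusM n m v : T n (T m v) = sigma n m *: T (n + m) v.
Proof. by rewrite Hassoc qmonM torus1Z actZl. Qed.

Lemma torusC n m v : T n (T m v) = commf q n m *: T m (T n v).
Proof. by rewrite !torusM scalerA mulfVK ?sigma_neq0 // addrC. Qed.

Lemma torusNK n v : sigma n n *: T (- n) (T n v) = v.
Proof.
by rewrite torusM scalerA sigmaNl mulfV ?sigma_neq0 // scale1r addNr Hunit.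
Qed.

Lemma torusKN n v : T n (sigma n n *: T (- n) v) = v.
Proof.
by rewrite actZr torusM scalerA sigmaNr mulfV ?sigma_neq0 // scale1r subrr Hunit.
Qed.

Lemma torus_inj n : injective (fun v => T n v).
Proof. by move=> v w /= e; rewrite -[v](torusNK n) e torusNK. Qed.

Definition ad_fixed (v : V) : Prop := forall n, A (ad (qmon n)) v = 0.

Lemma ad_torus s n v : ad_fixed v ->
  A (ad (qmon s)) (T n v) = (sigma s n - sigma n s) *: T (n + s) v.
Proof.
move=> hv; rewrite act_der_torus hv act0r add0r ad_qmon torus1Z actZl.
by rewrite [s + n]addrC.
Qed.

Lemma ad_rad r : in_rad q r -> ad (qmon r) = 0.
Proof.
by move=> rr; apply: der_ext => x /=; rewrite (in_rad_central x rr) subrr.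
Qed.

Let R n v := T n v - A (ad (qmon n)) v.

Let RS n v : R n v = - act (torus2 (qmon n)) v.
Proof. by rewrite /R actBl opprB. Qed.

Let RM n m v : R n (R m v) = sigma m n *: R (n + m) v.
Proof.
rewrite RS (RS m) -[- act _ v]sub0r actBr act0r sub0r opprK Hanti qmonM linearZ.
by rewrite actZl RS scalerN addrC.
Qed.

Let RT n m v : R n (T m v) = T m (R n v).
Proof.
rewrite /R act_der_torus ad_qmon torus1Z actZl actBr !torusM [m + n]addrC.
by rewrite scalerBl opprD opprB addrCA [_ *: _ + (_ - _)]addrC subrK addrC.
Qed.

(** This is T(n)^-1 R(n), the inverse of T(n) being [sigma n n] times T(-n). *)
Let U n v := sigma n n *: T (- n) (R n v).

Let TU n v : T n (U n v) = R n v.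
Proof. exact: torusKN. Qed.

Let RZ n a v : R n (a *: v) = a *: R n v.
Proof. by rewrite /R !actZr scalerBr. Qed.
Let RD n v w : R n (v + w) = R n v + R n w.
Proof. by rewrite /R !actDr opprD addrACA. Qed.
Let UZ n a v : U n (a *: v) = a *: U n v.
Proof. by rewrite /U RZ actZr !scalerA mulrC. Qed.
Let UD n v w : U n (v + w) = U n v + U n w.
Proof. by rewrite /U RD actDr scalerDr. Qed.
Let U0 n : U n 0 = 0.
Proof. by apply: (addrI (U n 0)); rewrite -UD !addr0. Qed.

(** The left action in the order [m], [n] and the right action in the order [n], [m] carry the same
    factor [sigma m n], so it cancels and [U] is a genuine representation. *)
Let UM n m v : U n (U m v) = U (n + m) v.
Proof.
apply: (torus_inj (n := n)); apply: (torus_inj (n := m)) => /=.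
rewrite TU -RT TU RM torusM [m + n]addrC TU.
by [].
Qed.

Let UT n m v : U n (T m v) = commf q m n *: T m (U n v).
Proof.
by apply: (torus_inj (n := n)); rewrite /= TU actZr RT -TU torusC.
Qed.

Let Urad n v : in_rad q n -> U n v = v.
Proof. by move=> nr; rewrite /U /R ad_rad // act0l subr0 torusNK. Qed.

Let Ufix v : (forall n, U n v = v) -> ad_fixed v.
Proof.
move=> Uv n; have := TU n v; rewrite Uv /R => /eqP.
by rewrite -subr_eq0 opprB addrC subrK => /eqP.
Qed.

(* The P m below are the projections of v, up to a scalar, to the isotypic
   components of the representation U of Z^d / rad(f); by orthogonality of
   characters their sum is a nonzero multiple of v. *)
Lemma ad_fixed_exists (Q : Zd -> V -> Prop) (r : Zd) (v : V) :
  (forall r, Q r 0) -> (forall r x y, Q r x -> Q r y -> Q r (x + y)) ->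
  (forall r a x, Q r x -> Q r (a *: x)) ->
  (forall r n x, Q r x -> Q (r + n) (T n x)) ->
  (forall r n x, Q r x -> Q (r + n) (A (ad (qmon n)) x)) ->
  Q r v -> v <> 0 -> exists r0 w, [/\ Q r0 w, w <> 0 & ad_fixed w].
Proof.
move=> Q0 QD QZ QT Qad Qv v0; have [N Nrad] := in_rad_multiples q.
have QU s n x : Q s x -> Q s (U n x).
  move=> Qx; rewrite -[s](addrK n); apply/QZ/QT; rewrite /R -scaleN1r.
  by apply: QD; [apply: QT | apply/QZ/Qad].
have UN n z w : U (n + z *+ N.+1) w = U n w by rewrite -UM [U (z *+ _) _]Urad.
have fNr m n z : commf q m (n + z *+ N.+1) = commf q m n.
  by rewrite commfDr [commf q m (_ *+ _)]commfV Nrad invr1 mulr1.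
have fNl m n z : commf q (n + z *+ N.+1) m = commf q n m.
  by rewrite commfDl Nrad mulr1.
pose P m := \sum_x (commf q m (@box_int d N x))^-1 *: U (box_int x) v.
have UP n m : U n (P m) = commf q m n *: P m.
  pose g k := (commf q m k)^-1 *: U k v.
  rewrite /P -[in RHS](@sum_box d N _ g n) /g => [|k z]; last by rewrite fNr UN.
  rewrite scaler_sumr (big_morph _ (UD n) (U0 n)); apply: eq_bigr => x _.
  rewrite UZ UM [RHS]scalerA [n + _]addrC; congr (_ *: _).
  by rewrite commfDr (invfM (commf q m _)) mulrCA mulfV ?commf_neq0 // mulr1.
(* Translating [y] by a [k] with f(x, k) different from 1 multiplies the sum by f(x, k). *)
have sum0 x : ~ in_rad q x -> \sum_y (commf q (@box_int d N y) x)^-1 = 0.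
  move=> nx; have [k fk] : exists k, commf q x k != 1.
    apply: contrapT => h; apply: nx => k; apply: contrapT => /eqP fk.
    by apply: h; exists k.
  have := @sum_box d N C^o (fun y => (commf q y x)^-1) k.
  rewrite (eq_bigr (fun y => (commf q (box_int y) x)^-1 * commf q x k)); last first.
    by move=> y _; rewrite commfDl (invfM (commf q _ x)) -[(commf q k x)^-1]commfV.
  rewrite -mulr_suml => /(_ _)/eqP.
  rewrite -subr_eq0 -[X in _ - X]mulr1 -mulrBr mulf_eq0 subr_eq0 (negPf fk) orbF => h.
  by apply/eqP/h => y z; rewrite fNl.
have [y Py] : exists y, P (@box_int d N y) <> 0.
  apply: contrapT => nP; apply: v0.
  have P0 y : P (@box_int d N y) = 0.
    by apply: contrapT => Py; apply: nP; exists y.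
  (* The sum of all [P (box_int y)] is [c *: v]. The inner sums are nonnegative, and the one for
     [x = 0] is the number of classes, so [c] is positive. *)
  pose c := \sum_(x : 'rV['I_N.+1]_d) \sum_(y : 'rV['I_N.+1]_d)
    (commf q (box_int y) (box_int x))^-1.
  have cv : c *: v = 0.
    transitivity (\sum_(y : 'rV['I_N.+1]_d) P (box_int y)).
      rewrite exchange_big /= /c scaler_suml; apply: eq_bigr => x _.
      rewrite -scaler_suml.
      case: (pselect (in_rad q (box_int x))) => [xr|xr]; first by rewrite Urad.
      by rewrite sum0 // !scale0r.
    by apply: big1 => y _; exact: P0.
  suff c0 : c != 0 by move/eqP: cv; rewrite scaler_eq0 (negPf c0) => /eqP.
  rewrite gt_eqF // /c (bigD1 0) //= ltr_pwDl //.
    rewrite (eq_bigr (fun=> 1)) => [|y _]; last first.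
      by rewrite box_int0 /commf sigma0r sigma0l !invr1 mulr1 ?invr1.
    by rewrite sumr_const ltr0n; apply/card_gt0P; exists 0.
  apply: sumr_ge0 => x _.
  case: (pselect (in_rad q (box_int x))) => [xr|xr]; last by rewrite sum0.
  by apply: sumr_ge0 => y _; rewrite -commfV xr.
(* [U n] acts on [P (box_int y)] by f(y, n), and by [UT] the operator T(-y) contributes the inverse
   factor: the result is fixed by [U]. *)
exists (r - box_int y), (T (- box_int y) (P (box_int y))); split.
- apply: QT; rewrite /P; elim/big_ind: _ => [|a b|x _]; [exact: Q0|exact: QD|].
  by apply/QZ/QU.
- by move=> e; apply: Py; apply: (torus_inj (n := - box_int y)); rewrite /= e act0r.
- apply: Ufix => n; rewrite UT UP actZr scalerA commfNl mulVf ?commf_neq0 //.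
  by rewrite scale1r.
Qed.

End Bimodule.

(** * Coordinates on finite dimensional subspaces *)

Section Basis.
Variables (C : fieldType) (V : lmodType C).

(** A maximal independent family in [P] spans it. Its size is bounded, since the coefficient matrix
    of too many vectors has a nonzero left kernel. *)
Lemma fin_dim_basis (W P : V -> Prop) :
  fin_dim W -> (forall v, P v -> W v) -> P 0 ->
  (forall v w, P v -> P w -> P (v + w)) -> (forall a v, P v -> P (a *: v)) ->
  exists n (phi : 'cV[C]_n -> V),
    [/\ linear phi, injective phi & forall v, P v <-> exists c, v = phi c].
Proof.
move=> [N [f [_ fW]]] PW P0 PD PZ.
pose comb n (e : 'I_n -> V) (c : 'cV[C]_n) := \sum_i c i 0 *: e i.
have comb_lin n e : linear (@comb n e).
  move=> a c c'; rewrite /comb scaler_sumr -big_split; apply: eq_bigr => i _.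
  by rewrite !mxE scalerDl scalerA.
pose indep n := exists e : 'I_n -> V,
  (forall i, P (e i)) /\ (forall c, comb n e c = 0 -> c = 0).
have i0 : exists n, `[< indep n >].
  exists 0%N; apply/asboolP; exists (fun=> 0); split=> // c _.
  by apply/colP => -[].
have ib n : `[< indep n >] -> (n <= N)%N.
  move=> /asboolP[e [eP efree]]; rewrite leqNgt; apply/negP => Nn.
  have [A AE] := choice (fun i => fW _ (PW _ (eP i))).
  pose M := \matrix_(i, j) A i j.
  have : kermx M != 0.
    rewrite kermx_eq0 /row_free neq_ltn.
    by rewrite (leq_ltn_trans (rank_leq_col M)).
  move=> /rowV0Pn[c /sub_kermxP cM /eqP]; apply.
  apply: trmx_inj; rewrite trmx0; apply: efree; rewrite /comb.
  transitivity (\sum_j (c *m M) 0 j *: f j); last first.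
    by rewrite cM big1 // => j _; rewrite mxE scale0r.
  transitivity (\sum_i \sum_j (c 0 i * A i j) *: f j).
    apply: eq_bigr => i _; rewrite mxE AE scaler_sumr.
    by apply: eq_bigr => j _; rewrite scalerA.
  rewrite exchange_big; apply: eq_bigr => j _ /=.
  by rewrite mxE scaler_suml; apply: eq_bigr => i _; rewrite mxE.
case: (ex_maxnP i0 ib) => n /asboolP[e [eP efree]] nmax.
exists n, (comb n e); split=> [|c c' cc'|v]; first exact: comb_lin.
  apply/eqP; rewrite -subr_eq0; apply/eqP/efree.
  have -> : c - c' = -1 *: c' + c by rewrite scaleN1r addrC.
  by rewrite comb_lin cc' scaleN1r addNr.
split=> [Pv|[c ->]]; last first.
  by apply: (big_ind P) => // i _; apply: PZ.
apply: contrapT => nv.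
suff /nmax : `[< indep n.+1 >] by rewrite ltnn.
apply/asboolP; exists (fun i => if unlift ord0 i is Some j then e j else v).
split=> [i|c]; first by case: unliftP.
rewrite /comb big_ord_recl unlift_none.
pose c' : 'cV_n := \col_j c (lift ord0 j) 0.
rewrite (eq_bigr (fun j => c' j 0 *: e j)) -/(comb n e c') => [ce|j _]; last first.
  by rewrite liftK mxE.
have c0 : c ord0 0 = 0.
  apply/eqP/negPn/negP => c0; apply: nv; exists (- (c ord0 0)^-1 *: c').
  have c00 : comb n e 0 = 0 by rewrite /comb big1 // => j _; rewrite mxE scale0r.
  have := comb_lin n e (- (c ord0 0)^-1) c' 0; rewrite c00 !addr0 => ->.
  rewrite scaleNr -scalerN; move/eqP: ce; rewrite addr_eq0 => /eqP <-.
  by rewrite scalerA mulVf // scale1r.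
move: ce; rewrite c0 scale0r add0r => /efree c'0.
apply/colP => i; rewrite mxE; case: (unliftP ord0 i) => [j ->|->//].
by have := congr1 (fun M : 'cV_n => M j 0) c'0; rewrite !mxE.
Qed.

Lemma linear_matrix n (phi : 'cV[C]_n -> V) (f : V -> V) :
  linear phi -> linear f -> (forall c, exists c', f (phi c) = phi c') ->
  exists M : 'M[C]_n, forall c, f (phi c) = phi (M *m c).
Proof.
move=> lphi lf fphi.
have [g gE] := choice (fun i : 'I_n => fphi (delta_mx i 0)).
exists (\matrix_(i, j) g j i 0) => c.
pose Lphi : {linear 'cV[C]_n -> V} :=
  HB.pack phi (GRing.isLinear.Build _ _ _ _ phi lphi).
pose Lf : {linear V -> V} := HB.pack f (GRing.isLinear.Build _ _ _ _ f lf).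
rewrite -[phi c]/(Lphi c) -[phi (_ *m c)]/(Lphi (_ *m c)) -[f _]/(Lf _).
have -> : (\matrix_(i, j) g j i 0) *m c = \sum_j c j 0 *: g j.
  apply/colP => i; rewrite !mxE summxE; apply: eq_bigr => j _.
  by rewrite !mxE mulrC.
rewrite {1}[c](matrix_sum_delta) !linear_sum; apply: eq_bigr => j _.
by rewrite big_ord1 !linearZ /= gE.
Qed.

End Basis.

(** * The radical of f as a group *)

Section RadicalGroup.
Variables (C : fieldType) (d : nat) (q : quantum_matrix C d).

Definition radical : {pred 'rV[int]_d} := fun n => `[< in_rad q n >].

Lemma radical_zmod_closed : zmod_closed radical.
Proof.
split=> [|r s /asboolP hr /asboolP hs]; apply/asboolP; first exact: in_rad0.
exact/in_radD/in_radN.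
Qed.

HB.instance Definition _ :=
  GRing.isZmodClosed.Build 'rV[int]_d radical radical_zmod_closed.

Record rad := Rad { rad_val :> 'rV[int]_d; _ : rad_val \in radical }.

HB.instance Definition _ := [isSub for rad_val].
HB.instance Definition _ := [Choice of rad by <:].
HB.instance Definition _ := [SubChoice_isSubZmodule of rad by <:].

Lemma radP (r : rad) : in_rad q r.
Proof. by case: r => r /= /asboolP. Qed.

Lemma rad_valD (r s : rad) : rad_val (r + s) = rad_val r + rad_val s.
Proof. exact: (raddfD (val : rad -> _)). Qed.

Lemma rad_val0 : rad_val 0 = 0.
Proof. exact: (raddf0 (val : rad -> _)). Qed.

Definition mkrad r (rr : in_rad q r) : rad := Rad (asboolT rr).

(** Modulo the multiples of the [ge i], every element reduces to a box representative, which again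
    lies in the radical. *)
Lemma rad_gens N (Nrad : forall n, in_rad q (n *+ N.+1)) :
  exists gens : seq rad, forall P : rad -> Prop, P 0 ->
  (forall s t, P s -> P t -> P (s + t)) -> (forall s, P s -> P (- s)) ->
  {in gens, forall g, P g} -> forall s, P s.
Proof.
(* Box points outside the radical are sent to the default value 0. *)
pose bx (x : 'rV['I_N.+1]_d) : rad := insubd 0 (box_int x).
pose ge i := mkrad (Nrad (delta_mx 0 i)).
exists ([seq bx x | x : 'rV['I_N.+1]_d] ++ [seq ge i | i : 'I_d]) => P P0 PD PN Pg s.
have [x [z sE]] := box_intP N (val s).
have Pz : P (mkrad (Nrad z)).
  have -> : mkrad (Nrad z) = \sum_i ge i *~ z 0 i.
    apply: val_inj; rewrite raddf_sum [LHS]/= {1}(row_sum_delta z) -sumrMnl.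
    apply: eq_bigr => i _; rewrite raddfMz /= -scaler_int -scalerMnr.
    by rewrite intz.
  elim/big_ind: _ => [||i _]; [exact: P0 | exact: PD |].
  have Pk k : P (ge i *+ k).
    elim: k => [|k IHk]; first by rewrite mulr0n.
    rewrite mulrS; apply: PD => //; apply: Pg.
    by rewrite mem_cat; apply/orP; right; apply: codom_f.
  case: (z 0 i) => k; first exact: Pk.
  by rewrite NegzE mulrNz; apply/PN/Pk.
have xr : box_int x \in radical.
  have -> : box_int x = val (s - mkrad (Nrad z)).
    by rewrite -[LHS](addrK (z *+ N.+1)) -sE raddfB.
  by case: (s - _).
have -> : s = bx x + mkrad (Nrad z).
  by apply: val_inj; rewrite raddfD [LHS]sE /= insubdK.
by apply: PD => //; apply: Pg; rewrite mem_cat; apply/orP; left; apply: codom_f.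
Qed.

End RadicalGroup.

(** * Weights and vectors killed by all ad t^n *)

Section WeightSpaces.
Variables (C : numFieldType) (d : nat) (q : quantum_matrix C d).
Variables (V : lmodType C) (act : qalg q -> V -> V).
Hypothesis Hmod : lie_module (@sd_br C (qtorus q)) act.
Variable alpha0 : 'rV[C]_d.
Local Notation T n v := (act (torus1 (qmon q n)) v).
Local Notation A D v := (act (of_der D) v).
Local Notation wt := (weight_space act alpha0).

Lemma weight0 r : wt r 0.
Proof. by move=> u; rewrite act0r // scaler0. Qed.

Lemma weightD r v w : wt r v -> wt r w -> wt r (v + w).
Proof. by move=> hv hw u; rewrite actDr // hv hw scalerDr. Qed.

Lemma weightZ r a v : wt r v -> wt r (a *: v).
Proof. by move=> hv u; rewrite actZr // hv !scalerA mulrC. Qed.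

Lemma weight_dot u r n :
  dot u (intv C (r + n) + alpha0) = dot u (intv C r + alpha0) + dot u (intv C n).
Proof. by rewrite -dotDr intvD addrAC. Qed.

Lemma Dur0_qmon u n :
  Dur u (in_rad0 q) (qmon q n) = dot u (intv C n) *: qmon q n.
Proof. by rewrite Dur_qmon sigma0l mulr1 add0r. Qed.

Lemma weight_torus r n v : wt r v -> wt (r + n) (T n v).
Proof.
move=> hv u; rewrite act_der_torus // hv actZr // Dur0_qmon torus1Z actZl //.
by rewrite -scalerDl weight_dot.
Qed.

Lemma weight_ad r n v : wt r v -> wt (r + n) (A (ad (qmon q n)) v).
Proof.
move=> hv u; rewrite act_der_ad // hv actZr // Dur0_qmon linearZ of_derZ actZl //.
by rewrite -scalerDl weight_dot.
Qed.

Lemma weight_Dur s r (rr : in_rad q r) u v : wt s v -> wt (s + r) (A (Dur u rr) v).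
Proof.
move=> hv w; rewrite act_der_der // hv actZr //.
have -> : der_br (Dur w (in_rad0 q)) (Dur u rr) = dot w (intv C r) *: Dur u rr.
  apply: der_ext; apply: qmon_ext => [||n]; try exact: der_linear.
  rewrite derZ -[der_br _ _ _]/(Dur w _ (Dur u rr _) - Dur u rr (Dur w _ _)).
  rewrite Dur0_qmon Dur_qmon !der_scaler Dur0_qmon Dur_qmon !scalerA -scalerBl.
  by congr (_ *: _); rewrite intvD dotDr; ring.
by rewrite of_derZ actZl // -scalerDl weight_dot.
Qed.

Lemma fixed_Dur r (rr : in_rad q r) u v :
  ad_fixed act v -> ad_fixed act (A (Dur u rr) v).
Proof.
move=> hv n; apply/eqP; rewrite -[X in _ == X](act0r Hmod (of_der (Dur u rr))).
rewrite -(hv n).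
by rewrite act_der_ad // Dur_qmon linearZ of_derZ actZl // hv scaler0 addr0.
Qed.

Lemma fixed_torus r v : in_rad q r -> ad_fixed act v -> ad_fixed act (T r v).
Proof.
by move=> /in_radE rr hv n; rewrite ad_torus // rr subrr scale0r.
Qed.

Lemma fixedD v w : ad_fixed act v -> ad_fixed act w -> ad_fixed act (v + w).
Proof. by move=> hv hw n; rewrite actDr // hv hw addr0. Qed.

Lemma fixedZ a v : ad_fixed act v -> ad_fixed act (a *: v).
Proof. by move=> hv n; rewrite actZr // hv scaler0. Qed.

Lemma fixed0 : ad_fixed act 0.
Proof. by move=> n; rewrite act0r. Qed.

End WeightSpaces.
Lemma mulmx_ext (R : pzSemiRingType) m n (M M' : 'M[R]_(m, n)) :
  (forall c : 'cV_n, M *m c = M' *m c) -> M = M'.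
Proof.
move=> MM; apply/matrixP => i j; have := MM (delta_mx j 0).
by rewrite -!colE => /colP/(_ i); rewrite !mxE.
Qed.

(** * Reconstruction of the module *)

Section Reconstruction.
Variables (C : numClosedFieldType) (d : nat) (q : quantum_matrix C d).
Variables (V : lmodType C) (act : qalg q -> V -> V).
Hypothesis Hmod : lie_module (@sd_br C (qtorus q)) act.
Hypothesis Hirr : lie_irreducible act.
Hypothesis Hassoc : torus1_associative act.
Hypothesis Hunit : forall v : V, act (torus1 (qmon q 0)) v = v.
Variables (alpha0 : 'rV[C]_d) (r0 : 'rV[int]_d).
Hypothesis Hsum : direct_sum (weight_space act alpha0).
(** The dimension is positive, so that the square matrices form a nonzero ring. *)
Variables (n' : nat).
Local Notation n := n'.+1.
Variable phi : 'cV[C]_n -> V.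
Hypothesis phi_linear : linear phi.
Hypothesis phi_inj : injective phi.
Hypothesis phiP : forall v,
  weight_space act alpha0 r0 v /\ ad_fixed act v <-> exists c, v = phi c.

Local Notation T n v := (act (torus1 (qmon q n)) v).
Local Notation A D v := (act (of_der D) v).
Local Notation G := (rad q).
Local Notation Cd := 'rV[C]_d.

Let phi_weight c : weight_space act alpha0 r0 (phi c).
Proof. exact: ((phiP _).2 (ex_intro _ c erefl)).1. Qed.
Let phi_fixed c : ad_fixed act (phi c).
Proof. exact: ((phiP _).2 (ex_intro _ c erefl)).2. Qed.

Let phiD c c' : phi (c + c') = phi c + phi c'.
Proof. by have := phi_linear 1 c c'; rewrite !scale1r. Qed.
Let phi0 : phi 0 = 0.
Proof. by apply: (addrI (phi 0)); rewrite -phiD !addr0. Qed.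
Let phiZ a c : phi (a *: c) = a *: phi c.
Proof. by have := phi_linear a c 0; rewrite phi0 !addr0. Qed.

(** T(r)^-1 D(u, r) preserves both the weight [r0] and [ad_fixed], so it acts on the image of
    [phi]. *)
Lemma weight_matrix_exists u (r : G) : exists M : 'M[C]_n, forall c,
  A (Dur u (radP r)) (phi c) = T r (phi (M *m c)).
Proof.
pose f v := sigma q r r *: T (- val r) (A (Dur u (radP r)) v).
have [] := @linear_matrix C V n phi f phi_linear.
- move=> a v w; rewrite /f !(actDr Hmod) !(actZr Hmod) scalerDr !scalerA.
  by rewrite mulrC.
- move=> c; apply/phiP; split; last first.
    apply: fixedZ => //; apply: fixed_torus => //; first exact/in_radN/radP.
    exact: fixed_Dur.
  rewrite -[r0](addrK (val r)); apply: weightZ => //; apply: weight_torus => //.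
  exact: weight_Dur.
move=> M ME; exists M => c.
by rewrite -ME /f (torusKN Hmod).
Qed.

Variable X : Cd -> G -> 'M[C]_n.
Hypothesis X_def : forall u (r : G) c,
  A (Dur u (radP r)) (phi c) = T r (phi (X u r *m c)).

Let XE u (r : G) (rr : in_rad q r) c : A (Dur u rr) (phi c) = T r (phi (X u r *m c)).
Proof. by rewrite (Prop_irrelevance rr (radP r)) X_def. Qed.

Let XE_D u (r s : G) (rs : in_rad q (r + s)) c :
  A (Dur u rs) (phi c) = T (val r + val s) (phi (X u (r + s) *m c)).
Proof.
move: rs; rewrite -rad_valD => rs; exact: XE.
Qed.

Let TradC (r : G) m v : T m (T r v) = T r (T m v).
Proof.
by rewrite (torusC Hmod Hassoc) commfV (radP r) invr1 scale1r.
Qed.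

Let XT u (r : G) (rr : in_rad q r) m c : A (Dur u rr) (T m (phi c)) =
  T r (T m (phi (X u r *m c + dot u (intv C m) *: c))).
Proof.
rewrite (act_der_torus Hmod) XE TradC Dur_qmon -scalerA -qmonM torus1Z (actZl Hmod).
by rewrite -Hassoc -!(actZr Hmod) -phiZ -!(actDr Hmod) -phiD.
Qed.

Let b (u : Cd) (r : G) : C := dot u (intv C r).

Let dotZl a (u w : Cd) : dot (a *: u) w = a * dot u w.
Proof. by rewrite /dot mulr_sumr; apply: eq_bigr => i _; rewrite mxE mulrA. Qed.

Let bD u : {morph b u : r s / r + s}.
Proof. by move=> r s; rewrite /b rad_valD intvD dotDr. Qed.

Let X_linear r : linear (X^~ r).
Proof.
move=> a u v; apply: mulmx_ext => c; apply: phi_inj.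
apply: (torus_inj Hmod Hassoc Hunit (n := val r)) => /=.
rewrite -(XE _ (radP r)) Dur_linear of_derD of_derZ (actDl Hmod) (actZl Hmod) !XE.
by rewrite mulmxDl phiD (actDr Hmod) -scalemxAl phiZ (actZr Hmod).
Qed.

Let XB u v r : X (u - v) r = X u r - X v r.
Proof.
have -> : u - v = -1 *: v + u by rewrite scaleN1r addrC.
by rewrite X_linear scaleN1r addrC.
Qed.
Let X0 r : X 0 r = 0.
Proof. by rewrite -[0](subrr 0) XB subrr. Qed.
Let XZ a u r : X (a *: u) r = a *: X u r.
Proof. by have := X_linear r a u 0; rewrite X0 !addr0. Qed.
Let XD u v r : X (u + v) r = X u r + X v r.
Proof. by have := X_linear r 1 u v; rewrite !scale1r. Qed.

(** This is the bracket of D(u, r) and D(v, s) evaluated on [phi c], with the injective [T r] and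
    [T s] cancelled. *)
Let XR u v r s : X u r * X v s - X v s * X u r =
  b u s *: (X v (r + s) - X v s) - b v r *: (X u (r + s) - X u r).
Proof.
suff E : X u r *m X v s - X v s *m X u r =
    b u s *: (X v (r + s) - X v s) - b v r *: (X u (r + s) - X u r) by exact: E.
apply: mulmx_ext => c.
have := act_der_der Hmod (Dur u (radP r)) (Dur v (radP s)) (phi c).
rewrite !XE !XT (der_br_Dur _ _ _ _ (in_radD (radP r) (radP s))).
rewrite of_derZ (actZl Hmod) XE_D.
rewrite -(torusM Hmod Hassoc) (TradC r s) -!(actDr Hmod).
move=> /(torus_inj Hmod Hassoc Hunit)/(torus_inj Hmod Hassoc Hunit) /=.
rewrite -phiD => /phi_inj; rewrite XB !XZ.
rewrite !mulmxBl -!scalemxAl !mulmxBl -!mulmxA /b.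
move: (X u r *m (X v s *m c)) (X v s *m (X u r *m c)) => P P'.
move: (X v s *m c) (X u r *m c) => x y.
move: (X v (r + s) *m c) (X u (r + s) *m c) (dot u _) (dot v _) => Z W k l e.
apply/colP => i; have := congr1 (fun M : 'cV_n => M i 0) e.
rewrite !mxE => /eqP; rewrite -subr_eq0 => /eqP ei.
by apply/eqP; rewrite -subr_eq0 -ei; apply/eqP; ring.
Qed.

Let X_0 u : X u 0 = (dot u (intv C r0 + alpha0))%:M.
Proof.
apply: mulmx_ext => c; apply: phi_inj; rewrite mul_scalar_mx phiZ.
by rewrite -(phi_weight c u) (@XE u 0) rad_val0 Hunit.
Qed.

(** This is the inverse of the isomorphism sought, sending c(k) to T(k) applied to [phi c]. *)
Definition Psi (x : tensq d 'cV[C]_n) : V :=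
  \sum_(k <- msupp x) T k (phi (fscoef k x)).

Let PsiEw (D : {fset 'rV[int]_d}) x : (msupp x `<=` D)%fset ->
  Psi x = \sum_(k <- D) T k (phi (fscoef k x)).
Proof.
move=> sD; rewrite /Psi (big_fset_incl _ sD) // => k _ kN.
by rewrite fs_outdom // phi0 (act0r Hmod).
Qed.

Lemma Psi_linear : linear Psi.
Proof.
move=> a x y; pose D := (msupp x `|` msupp y `|` msupp (a *: x + y)%R)%fset.
rewrite !(@PsiEw D);
  try by apply/fsubsetP => k ka; rewrite !inE ka ?orbT.
rewrite scaler_sumr -big_split /=; apply: eq_bigr => k _.
by rewrite fscoefD fscoefZ phi_linear (actDr Hmod) (actZr Hmod).
Qed.

Lemma Psi_tens c k : Psi (tens c k) = T k (phi c).
Proof.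
rewrite /Psi msupp_delta; case: eqP => [->|_].
  by rewrite big_seq_fset0 phi0 (act0r Hmod).
by rewrite big_seq_fset1 fscoef_delta eqxx.
Qed.

Let PsiD x y : Psi (x + y) = Psi x + Psi y.
Proof. by have := Psi_linear 1 x y; rewrite !scale1r. Qed.
Let Psi0 : Psi 0 = 0.
Proof. by apply: (addrI (Psi 0)); rewrite -PsiD !addr0. Qed.
Let PsiZ a x : Psi (a *: x) = a *: Psi x.
Proof. by have := Psi_linear a x 0; rewrite Psi0 !addr0. Qed.
Let PsiB x y : Psi (x - y) = Psi x - Psi y.
Proof. by apply: (addIr (Psi y)); rewrite -PsiD !subrK. Qed.

(** The summand of index [k] has weight [r0 + k], and the sum of the weight spaces is direct. *)
Lemma Psi_inj : injective Psi.
Proof.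
suff Pi x : Psi x = 0 -> x = 0.
  by move=> x y xy; apply/eqP; rewrite -subr_eq0; apply/eqP/Pi; rewrite PsiB xy subrr.
move=> Px; apply: fsP => k; rewrite fscoef0.
have [kx|/fs_outdom//] := boolP (k \in msupp x).
pose w i := T (i - r0) (phi (fscoef (i - r0) x)).
have := (Hsum.2 [seq r0 + j | j <- msupp x] w) _ _ _ (r0 + k).
rewrite [w (r0 + k)]/w [r0 + k]addrC addrK => w0.
apply: phi_inj; rewrite phi0; apply: (torus_inj Hmod Hassoc Hunit (n := k)).
rewrite /= (act0r Hmod); apply: w0.
- by rewrite map_inj_uniq ?fset_uniq //; exact: addrI.
- move=> i; rewrite /w -[i in weight_space _ _ i](subrK r0) addrC.
  exact: weight_torus.
- rewrite big_map -[RHS]Px /Psi; apply: eq_bigr => j _.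
  by rewrite /w [r0 + j]addrC addrK.
- by apply/mapP; exists k; rewrite // addrC.
Qed.

Lemma torus_Psi m c k :
  T m (Psi (tens c k)) = Psi (sigma q m k *: tens c (m + k)).
Proof. by rewrite PsiZ !Psi_tens (torusM Hmod Hassoc). Qed.

Lemma ad_Psi s c k : A (ad (qmon q s)) (Psi (tens c k)) =
  Psi ((sigma q s k - sigma q k s) *: tens c (k + s)).
Proof. by rewrite PsiZ !Psi_tens (ad_torus Hmod). Qed.

Lemma Dur_Psi u (r : G) (rr : in_rad q r) c k : A (Dur u rr) (Psi (tens c k)) =
  Psi (sigma q r k *: tens (X u r *m c + dot u (intv C k) *: c) (rad_val r + k)).
Proof. by rewrite PsiZ !Psi_tens XT (torusM Hmod Hassoc). Qed.

(** * Submodules coming from invariant subspaces *)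

Section Image.
Variable P : 'cV[C]_n -> Prop.
Hypothesis P0 : P 0.
Hypothesis PD : forall c c', P c -> P c' -> P (c + c').
Hypothesis PZ : forall a c, P c -> P (a *: c).
Hypothesis PX : forall u r c, P c -> P (X u r *m c).

Let image y := exists x : tensq d 'cV[C]_n, (forall k, P (fscoef k x)) /\ y = Psi x.

Let image0 : image 0.
Proof. by exists 0; split=> [k|]; rewrite ?fscoef0 ?Psi0. Qed.
Let imageD y z : image y -> image z -> image (y + z).
Proof.
move=> [x [xP ->]] [x' [xP' ->]]; exists (x + x'); rewrite PsiD; split=> // k.
by rewrite fscoefD; apply: PD.
Qed.
Let imageZ a y : image y -> image (a *: y).
Proof.
move=> [x [xP ->]]; exists (a *: x); rewrite PsiZ; split=> // k.
by rewrite fscoefZ; apply: PZ.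
Qed.
Let image_tens a c k : P c -> image (Psi (a *: tens c k)).
Proof.
move=> Pc; exists (a *: tens c k); split=> // l.
by rewrite fscoefZ fscoef_delta; apply: PZ; case: (k == l).
Qed.

(** By [der_spanned] only the [Dur], the [ad t^s] and the [t^m] need testing, and each keeps the
    coefficients in [P]. *)
Lemma image_submodule : lie_submodule act image.
Proof.
split=> // x _ [z [zP ->]].
suff act_tens c k : P c -> image (act x (Psi (tens c k))).
  rewrite (act_sumr Hmod); elim/big_ind: _ => // k _.
  by rewrite -Psi_tens; apply: act_tens.
case: x => D a Pc.
have -> : (D, a) = of_der D + torus1 a :> qalg q by congr pair; rewrite ?addr0 ?add0r.
rewrite (actDl Hmod); apply: imageD.
  move: D; apply: der_spanned => [|D E PDD PE|e D PDD|u r rr|s _].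
  - by rewrite (act0l Hmod).
  - by rewrite of_derD (actDl Hmod); apply: imageD.
  - by rewrite of_derZ (actZl Hmod); apply: imageZ.
  - rewrite (@Dur_Psi u (mkrad rr)); apply/image_tens/PD; [exact: PX|exact: PZ].
  - by rewrite ad_Psi; apply: image_tens.
rewrite (qtorus_sum a); elim: (msupp a : seq _) => [|m s IHs].
  by rewrite big_nil [torus1 0](_ : _ = 0) // (act0l Hmod).
rewrite big_cons torus1D (actDl Hmod); apply: imageD => //.
by rewrite torus1Z (actZl Hmod) torus_Psi; apply/imageZ/image_tens.
Qed.

(** As [Psi] is injective, [P] can be read off in degree 0 of its image. *)
Lemma X_irreducible : (forall c, P c -> c = 0) \/ (forall c, P c).
Proof.
have [h|h] := Hirr.2 _ image_submodule; [left => c Pc|right => c].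
  apply: phi_inj; rewrite phi0 -[phi c]Hunit -Psi_tens; apply: h.
  by rewrite -[tens c 0]scale1r; apply: image_tens.
have [x [xP /Psi_inj e]] := h (Psi (tens c 0)).
by have := xP 0; rewrite -e fscoef_delta eqxx.
Qed.

End Image.

(** The image is a submodule, nonzero because the dimension is positive. *)
Lemma Psi_surj y : exists x, y = Psi x.
Proof.
have [||||h|h] := Hirr.2 _ (@image_submodule (fun=> True) _ _ _ _) => //.
  have e := h _ (ex_intro _ (tens (const_mx 1) 0) (conj (fun=> I) erefl)).
  move: e; rewrite -Psi0 => /Psi_inj/(congr1 (fscoef 0)).
  rewrite fscoef_delta eqxx fscoef0 => /colP/(_ 0); rewrite !mxE => /eqP.
  by rewrite oner_eq0.
by have [x [_ ->]] := h y; exists x.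
Qed.

(** * The action of gl_d *)

Variable N : nat.
Hypothesis Nrad : forall r, in_rad q (r *+ N.+1).

Let N0 : N.+1%:R != 0 :> C.
Proof. by rewrite pnatr_eq0. Qed.

(** The basis vector e_i may lie outside the radical, but its multiple by [N.+1] does not; [us]
    compensates the factor. *)
Let rs (i : 'I_d) : G := mkrad (Nrad (delta_mx 0 i)).
Let us (i : 'I_d) : Cd := N.+1%:R^-1 *: delta_mx 0 i.

Let b_rs v i : b v (rs i) = v 0 i * N.+1%:R.
Proof.
rewrite /b /dot (bigD1 i) //= big1 => [|j ji].
  by rewrite addr0 !mxE mulmxnE mxE !eqxx rmorphMn.
by rewrite !mxE mulmxnE mxE (negPf ji) andbF mul0rn mulr0.
Qed.

Let b_us s i : b (us i) s = (rad_val s 0 i)%:~R / N.+1%:R.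
Proof.
rewrite /b /us dotZl mulrC; congr (_ / _).
rewrite /dot (bigD1 i) //= big1 => [|j ji].
  by rewrite addr0 !mxE !eqxx mul1r.
by rewrite !mxE (negPf ji) andbF mul0r.
Qed.

Let dual_l v : \sum_i b v (rs i) *: us i = v.
Proof.
rewrite [RHS]row_sum_delta; apply: eq_bigr => i _.
by rewrite b_rs /us scalerA mulfK.
Qed.

(** [s *+ N.+1] is an integral combination of the [rs i], and [N.+1] is invertible in the field. *)
Let dual_r (M : lmodType C) (c : G -> M) : {morph c : r s / r + s} ->
  forall s, \sum_i b (us i) s *: c (rs i) = c s.
Proof.
move=> cD s; have c0 : c 0 = 0 by apply: (addrI (c 0)); rewrite -cD !addr0.
have cn r k : c (r *+ k) = k%:R *: c r.
  elim: k => [|k IHk]; first by rewrite mulr0n scale0r.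
  by rewrite mulrS cD IHk mulrS scalerDl scale1r.
have cz r z : c (r *~ z) = z%:~R *: c r.
  case: z => k; first exact: cn.
  rewrite NegzE mulrNz; apply: (addIr (c (r *+ k.+1))).
  by rewrite -cD addNr c0 cn mulrNz scaleNr addNr.
have sE : s *+ N.+1 = \sum_i rs i *~ rad_val s 0 i.
  apply: val_inj; rewrite raddf_sum raddfMn [LHS]/=.
  rewrite {1}(row_sum_delta (rad_val s)) -sumrMnl.
  by apply: eq_bigr => i _; rewrite raddfMz /= -scaler_int -scalerMnr intz.
apply: (scalerI N0); rewrite -cn sE (big_morph c cD c0) scaler_sumr.
by apply: eq_bigr => i _; rewrite cz scalerA b_us mulrC mulfVK.
Qed.

Let b_nondegenerate (r : G) : r != 0 -> exists u, b u r = 1.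
Proof.
move=> r0'; have [i ri] : exists i, rad_val r 0 i != 0.
  apply: contrapT => nr; move/eqP: r0'; apply; apply: val_inj.
  rewrite [RHS]rad_val0; apply/rowP => i; rewrite mxE; apply: contrapT => /eqP ri.
  by apply: nr; exists i.
exists ((rad_val r 0 i)%:~R^-1 *: (N.+1%:R *: us i)).
rewrite /b dotZl dotZl -/(b _ _) b_us [N.+1%:R * _]mulrC mulfVK // mulVf //.
by rewrite intr_eq0.
Qed.

Let X_add u r s : X u (r + s) + X u 0 = X u r + X u s.
Proof.
have [gens gensP] := rad_gens Nrad.
apply: (@X_affine C G Cd 'M[C]_n b X bD X_linear _ XR b_nondegenerate gens gensP
  d us rs dual_l (@dual_r 'M[C]_n) 'cV[C]_n (@mulmx C n n 1)).
- exact: ad_eigenvector_eq0.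
- by move=> w a M M'; rewrite mulmxDl scalemxAl.
- by move=> M a w w'; rewrite mulmxDr scalemxAr.
- by move=> M M' w; rewrite mulmxA.
- by move=> M M0; apply: mulmx_ext => w; rewrite M0 mul0mx.
- by move=> M j j0; apply: eigenvector_top.
- by move=> P P0 PD PZ PX; apply: X_irreducible.
Qed.

Let I u r := X u r - X u 0.

Let ID u r s : I u (r + s) = I u r + I u s.
Proof. by rewrite /I addrACA -X_add addrA addrK. Qed.
Let IDl u v r : I (u + v) r = I u r + I v r.
Proof. by rewrite /I !XD opprD addrACA. Qed.
Let I0l r : I 0 r = 0.
Proof. by rewrite /I !X0 subrr. Qed.
Let IZ a u r : I (a *: u) r = a *: I u r.
Proof. by rewrite /I !XZ scalerBr. Qed.
Let IB u v r : I (u - v) r = I u r - I v r.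
Proof. by rewrite -scaleN1r IDl IZ scaleN1r. Qed.
Let Isum u_ r : I (\sum_(i < d) u_ i) r = \sum_i I (u_ i) r.
Proof. exact: (big_morph (I^~ r) (fun u v => IDl u v r) (I0l r)). Qed.

(** These are the commutators of rank one matrices: [r u^T, s v^T] = (u, s) r v^T - (v, r) s u^T. *)
Let I_br u v r s : I u r *m I v s - I v s *m I u r = b u s *: I v r - b v r *: I u s.
Proof.
have XI w p p' : X w (p + p') - X w p' = I w p.
  by apply/eqP; rewrite subr_eq addrAC -X_add addrK.
have <- := XI v r s; have <- := XI u s r; rewrite [s + r]addrC.
have <- := XR u v r s.
rewrite -[X u r * _]/(X u r *m X v s) -[X v s * _]/(X v s *m X u r).
rewrite /I !X_0 !mulmxBl !mulmxBr !mul_scalar_mx !mul_mx_scalar.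
move: (X u r *m X v s) (X v s *m X u r) (X u r) (X v s) => P Q x y.
by apply/matrixP => i j; rewrite !mxE; ring.
Qed.

(** A matrix is the sum of the rank one matrices e_i [row i M], and [rs i] is [N.+1] times e_i. *)
Let Rho M : 'M[C]_n := N.+1%:R^-1 *: \sum_i I (row i M) (rs i).

Let Rho_linear : linear Rho.
Proof.
move=> a M M'; rewrite /Rho scalerA mulrC -scalerA -scalerDr; congr (_ *: _).
rewrite scaler_sumr -big_split; apply: eq_bigr => i _ /=.
by rewrite linearP IDl IZ.
Qed.

Let Rho_rank1 (r : G) u : Rho ((intv C r)^T *m u) = I u r.
Proof.
rewrite -(dual_r (c := I u)) ?/Rho ?scaler_sumr; last exact: ID.
apply: eq_bigr => i _; rewrite b_us mulrC -scalerA.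
have -> : row i ((intv C r)^T *m u) = (rad_val r 0 i)%:~R *: u.
  by apply/rowP => j; rewrite !mxE big_ord1 !mxE.
by rewrite !IZ.
Qed.

Let Rho_br A B : Rho (gl_br A B) = Rho A *m Rho B - Rho B *m Rho A.
Proof.
have IAB (A' B' : 'M[C]_d) i : I (row i (A' *m B')) (rs i) =
    \sum_k A' i k *: I (row k B') (rs i).
  rewrite row_mul mulmx_sum_row Isum; apply: eq_bigr => k _.
  by rewrite IZ mxE.
have RR A' B' : Rho A' *m Rho B' = (N.+1%:R^-1 * N.+1%:R^-1) *:
    \sum_i \sum_k I (row i A') (rs i) *m I (row k B') (rs k).
  rewrite /Rho -scalemxAl -scalemxAr scalerA mulmx_suml; congr (_ *: _).
  by apply: eq_bigr => i _; rewrite mulmx_sumr.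
rewrite !RR [X in _ - _ *: X]exchange_big -scalerBr -sumrB.
apply: (scalerI N0); rewrite /Rho !scalerA mulrA mulfV // mul1r scale1r.
apply: (scalerI N0); rewrite [RHS]scalerA mulfV // scale1r.
transitivity (\sum_i \sum_k (b (row i A) (rs k) *: I (row k B) (rs i)
   - b (row k B) (rs i) *: I (row i A) (rs k))); last first.
  apply: eq_bigr => i _; rewrite -sumrB; apply: eq_bigr => k _.
  by rewrite I_br.
rewrite /gl_br (eq_bigr (fun i => \sum_k A i k *: I (row k B) (rs i) -
   \sum_k B i k *: I (row k A) (rs i))); last first.
  by move=> i _; rewrite linearB IB !IAB.
under [RHS]eq_bigr do rewrite sumrB.
rewrite !sumrB [X in _ = _ - X]exchange_big scalerBr !scaler_sumr.
congr (_ - _); apply: eq_bigr => i _; rewrite scaler_sumr; apply: eq_bigr => k _;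
  by rewrite scalerA b_rs mxE mulrC.
Qed.

Lemma Falpha_exists :
  exists (alpha : 'rV[C]_d) (W : vectType C) (rho : 'M[C]_d -> W -> W),
    [/\ lie_module (@gl_br C d) rho, lie_irreducible rho
      & exists F : qalg q -> tensq d W -> tensq d W,
          is_Falpha alpha rho F /\ lie_isomorphic act F].
Proof.
(* [alpha] is the weight of the image of [phi], which by [X_0] gives the scalars by which the D(u,
   0) act there. *)
exists (intv C r0 + alpha0), 'cV[C]_n, (fun M v => Rho M *m v); split.
- split=> [M a v w|v a M M'|M M' v].
  + by rewrite mulmxDr scalemxAr.
  + by rewrite Rho_linear mulmxDl scalemxAl.
  + by rewrite Rho_br mulmxBl !mulmxA.
- split.
    exists (const_mx 1) => /colP/(_ 0); rewrite !mxE => /eqP.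
    by rewrite oner_eq0.
  move=> P [P0 PD PZ PX]; apply: X_irreducible => // u r c Pc.
  (* A subspace stable under gl_d is stable under all [X u r], which differ from [Rho] of a rank one
     matrix by a scalar. *)
  have -> : X u r = Rho ((intv C r)^T *m u) + X u 0 by rewrite Rho_rank1 subrK.
  by rewrite mulmxDl X_0 mul_scalar_mx; apply: PD; [exact: PX | exact: PZ].
have [Theta PT] := choice Psi_surj.
have TP x : Theta (Psi x) = x by apply: Psi_inj; rewrite -PT.
(* The action is transported along [Psi], so only its formulas on the c(k) remain to be checked. *)
pose F x w := Theta (act x (Psi w)).
have PF x w : Psi (F x w) = act x (Psi w) by rewrite -PT.
exists F; split; last first.
  exists Theta; split=> [a v w||x v]; last by rewrite /F -PT.
    by apply: Psi_inj; rewrite Psi_linear -!PT.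
  by exists Psi => v; rewrite -?PT.
split=> [|s c k _|u r rr c k|m c k].
- split=> [x a v w|w a x y|x y w]; apply: Psi_inj.
  + by rewrite Psi_linear !PF Psi_linear (actDr Hmod) (actZr Hmod).
  + by rewrite Psi_linear !PF (actDl Hmod) (actZl Hmod).
  + by rewrite PsiB !PF (lie_act_br Hmod).
- by apply: Psi_inj; rewrite PF ad_Psi.
- apply: Psi_inj; rewrite PF (@Dur_Psi u (mkrad rr)); congr (Psi (_ *: tens _ _)).
  rewrite -[r in RHS]/(rad_val (mkrad rr)) (Rho_rank1 (mkrad rr)) /I mulmxBl X_0.
  rewrite mul_scalar_mx [dot u (intv C k + _)]dotDr scalerDl -addrA.
  by rewrite [_ *: c + (_ - _)]addrC subrK addrC.
by apply: Psi_inj; rewrite PF torus_Psi.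
Qed.

End Reconstruction.

Theorem theorem2p6 (R : realType) (d : nat) (q : quantum_matrix R[i] d)
    (V' : lmodType R[i]) (act : qalg q -> V' -> V')
    (Hmod : lie_module (@sd_br R[i] (qtorus q)) act)
    (Hirr : lie_irreducible act)
    (Hgr : Zd_graded act)
    (Hassoc : torus1_associative act)
    (Hanti : torus2_antiassociative act)
    (Hunit : forall v : V', act (torus1 (qmon q 0)) v = v) :
  exists (alpha : 'rV[R[i]]_d) (V : vectType R[i]) (rho : 'M[R[i]]_d -> V -> V),
    [/\ lie_module (@gl_br R[i] d) rho,
        lie_irreducible rho
      & exists F : qalg q -> tensq d V -> tensq d V,
          is_Falpha alpha rho F /\ lie_isomorphic act F].
Proof.
have [alpha0 [Hsum Hfin]] := Hgr; have [[v v0] _] := Hirr.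
have [r [v' [v'_wt v'0]]] : exists r v', weight_space act alpha0 r v' /\ v' <> 0.
  have [s [w [_ w_wt vE]]] := Hsum.1 v; apply: contrapT => h; apply: v0.
  rewrite vE big1 // => j _; apply: contrapT => wj; apply: h.
  by exists j, (w j).
have [r0 [w [w_wt w0 w_fix]]] := ad_fixed_exists Hmod Hassoc Hanti Hunit
  (fun r => weight0 Hmod alpha0 r) (weightD Hmod (alpha0 := alpha0))
  (weightZ Hmod (alpha0 := alpha0)) (weight_torus Hmod (alpha0 := alpha0))
  (weight_ad Hmod (alpha0 := alpha0)) v'_wt v'0.
pose P v := weight_space act alpha0 r0 v /\ ad_fixed act v.
have [||||n [phi [phi_lin phi_inj phiP]]] := fin_dim_basis (P := P) (Hfin r0).
- by move=> x [].
- by split; [exact: weight0 | exact: fixed0].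
- by move=> x y [xw xf] [yw yf]; split; [exact: weightD | exact: fixedD].
- by move=> a x [xw xf]; split; [exact: weightZ | exact: fixedZ].
case: n phi phi_lin phi_inj phiP => [|n] phi phi_lin phi_inj phiP.
  (* In dimension 0 the vector [w] would be [phi] of the only column, hence 0. *)
  have [c wE] := (phiP w).1 (conj w_wt w_fix).
  have := phi_lin 1 c c; rewrite (_ : 1 *: c + c = c); last by apply/colP => -[].
  rewrite scale1r -wE => /eqP.
  by rewrite -subr_eq0 opprD addrA subrr sub0r oppr_eq0 => /eqP.
have [N Nrad] := in_rad_multiples q.
have [X XP] := choice (fun p : 'rV_d * rad q =>
  weight_matrix_exists Hmod Hassoc Hunit phi_lin phiP p.1 p.2).
exact: (Falpha_exists Hmod Hirr Hassoc Hunit Hsum phi_lin phi_inj phiP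
  (X := fun u r => X (u, r)) (fun u r => XP (u, r)) Nrad).
Qed.
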